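(* Let $\lambda\vdash n$ be a non-self-conjugate partition of $n$, and let $\mathcal P=\mathrm{id}+\sum_{i=1}^{n-2}\big((i,n-1,n)+(i,n,n-1)\big)\in\mathbb C[A_n]$, acting on $\mathbb C[A_n]$ by multiplication on the right. For each $T_\alpha\in\mathrm{UStd}(\lambda)\cup\mathrm{UStd}(\lambda')$, write $\alpha=(a_1,\dots,a_n):=(c(T_\alpha,1),\dots,c(T_\alpha,n))$. For each such $T_\alpha$ we have an eigenvalue of $\mathcal P$, given as follows: (1) $2a_n-1$ is an eigenvalue of $\mathcal P$, if $a_n=a_{n-1}+1$. (2) $-(2a_n+1)$ is an eigenvalue of $\mathcal P$, if $a_n=a_{n-1}-1$. (3) $\pm(a_n+a_{n-1})$ are eigenvalues of $\mathcal P$, if $a_n\neq a_{n-1}\pm1$ and $a_{n-1}<a_n$. Moreover, each eigenvalue has multiplicity $d_\lambda$. Also, the sets of eigenvalues obtained by considering the partitions $\lambda$ and $\lambda'$ are the same.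
   Context: $A_n$ is the alternating group on $\{1,\dots,n\}$ and $\mathbb C[A_n]$ its group algebra. Partitions of $n$ are identified with Young diagrams; $\lambda'$ is the conjugate (transposed) partition of $\lambda$, and $\lambda$ is non-self-conjugate if $\lambda\neq\lambda'$. $\mathrm{Std}(\lambda)$ is the set of standard Young tableaux of shape $\lambda$ (filled with $1,\dots,n$, entries increasing along rows and down columns). The content of the box in row $i$ and column $j$ is $j-i$, and $c(T,m)$ is the content of the box labelled $m$ in $T$. $\mathrm{UStd}(\lambda)=\{T\in\mathrm{Std}(\lambda): c(T,2)=1\}$ is the set of upper standard Young tableaux of shape $\lambda$. For non-self-conjugate $\lambda$, $D_\lambda$ is the corresponding irreducible representation of $A_n$ (with $D_\lambda\cong D_{\lambda'}$), whose basis is indexed by $\mathrm{UStd}(\lambda)\cup\mathrm{UStd}(\lambda')$, and $d_\lambda=\dim D_\lambda=|\mathrm{UStd}(\lambda)|+|\mathrm{UStd}(\lambda')|=|\mathrm{Std}(\lambda)|$; $D_\lambda$ occurs in the regular representation $\mathbb C[A_n]$ with multiplicity $d_\lambda$. *)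

(* Defs.v *)
From HB Require Import structures.
From mathcomp Require Import all_boot all_order all_fingroup all_algebra.
From mathcomp Require Import all_solvable mxrepresentation.
From mathcomp Require Import complex reals.

Set Implicit Arguments.
Unset Strict Implicit.
Unset Printing Implicit Defensive.

Import GroupScope Order.TTheory GRing.Theory Num.Theory.
Local Open Scope ring_scope.

(* Points, rows and columns are numbered from 0: k : 'I_n stands for the      *)
(* label k + 1. Contents do not depend on this shift.                         *)

Definition is_partition (n : nat) (la : seq nat) : bool :=
  [&& sorted geq la, 0%N \notin la & sumn la == n].

Definition conj_partition (la : seq nat) : seq nat :=
  mkseq (fun j => count (fun l => (j < l)%N) la) (head 0%N la).

(* A filling is given by the map T from labels to boxes. All the boxes        *)
(* (row, column) of a partition of n lie in the n x n square.                 *)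
Section Tableaux.
Variable n : nat.

Definition box : Type := ('I_n * 'I_n)%type.

Definition diagram (la : seq nat) : {set 'I_n * 'I_n} :=
  [set b : 'I_n * 'I_n | (b.2 < nth 0%N la b.1)%N].

Definition tableau : finType := {ffun 'I_n -> 'I_n * 'I_n}.

Definition Std (la : seq nat) : {set tableau} :=
  [set T : tableau |
    [&& injectiveb T,
        [set T k | k : 'I_n] == diagram la,
        [forall k : 'I_n, forall l : 'I_n,
           ((T k).1 == (T l).1) && ((T k).2 < (T l).2)%N ==> (k < l)%N]
      & [forall k : 'I_n, forall l : 'I_n,
           ((T k).2 == (T l).2) && ((T k).1 < (T l).1)%N ==> (k < l)%N]]].

(* The sequence (c(T,1), ..., c(T,n)); its item of index m is c(T,m+1). *)
Definition contents (T : tableau) : seq int :=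
  [seq ((T k).2 : nat)%:Z - ((T k).1 : nat)%:Z | k <- enum 'I_n].

Definition UStd (la : seq nat) : {set tableau} :=
  [set T in Std la | (contents T)`_1 == 1].

(* The union of UStd(la) and UStd(la'). *)
Definition UStd2 (la : seq nat) : {set tableau} :=
  UStd la :|: UStd (conj_partition la).

Definition last_content (T : tableau) : int := (contents T)`_n.-1.
Definition prev_content (T : tableau) : int := (contents T)`_n.-2.

(* The list of eigenvalues attached to T; it is empty when T satisfies none   *)
(* of the three conditions, i.e. when a_n < a_(n-1) - 1.                      *)
Definition eigenvalues_of (T : tableau) : seq int :=
  let a := last_content T in
  let b := prev_content T in
  if a == b + 1 then [:: 2 * a - 1]
  else if a == b - 1 then [:: - (2 * a + 1)]
  else if b < a then [:: a + b; - (a + b)]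
  else [::].

(* Repetitions matter: they give the multiplicities. *)
Definition eigenvalue_list (la : seq nat) : seq int :=
  flatten [seq eigenvalues_of T | T <- enum (UStd2 la)].

End Tableaux.

(* Row vectors of dimension #|G| are elements of the group algebra of G, and  *)
(* regular_repr F G g is the matrix, acting on row vectors, of the right      *)
(* multiplication by g.                                                       *)

(* The 3-cycle (i, j, k) sending i to j, j to k and k to i, for i, j, k in    *)
(* {1, ..., n}; the value 1 outside of this range is irrelevant.              *)
Definition cycle3 (n i j k : nat) : {perm 'I_n} :=
  match (insub i.-1 : option 'I_n), (insub j.-1 : option 'I_n),
        (insub k.-1 : option 'I_n) with
  | Some a, Some b, Some c => (tperm a b * tperm a c)%g
  | _, _, _ => 1%g
  end.

(* The right multiplication by the element P on the group algebra of A_n. *)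
Definition Pmx (F : fieldType) (n : nat) : 'M[F]_#|'Alt_('I_n)| :=
  let R := regular_repr F 'Alt_('I_n) in
  R 1%g + \sum_(1 <= i < n.-1) (R (cycle3 n i n.-1 n) + R (cycle3 n i n n.-1)).

(* The Young symmetrizer of the tableau obtained by filling the rows of la    *)
(* with 0, ..., n - 1 in order, in which k is in row reshape_index la k and   *)
(* column reshape_offset la k.                                                *)
Definition row_stabilizer (n : nat) (la : seq nat) : {set {perm 'I_n}} :=
  [set s : {perm 'I_n} |
    [forall k, reshape_index la (s k) == reshape_index la k]].

Definition column_stabilizer (n : nat) (la : seq nat) : {set {perm 'I_n}} :=
  [set s : {perm 'I_n} |
    [forall k, reshape_offset la (s k) == reshape_offset la k]].

Definition young_symmetrizer (F : fieldType) (n : nat) (la : seq nat) :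
    'rV[F]_#|'Sym_('I_n)| :=
  \sum_(p in row_stabilizer n la) \sum_(q in column_stabilizer n la)
    (-1) ^+ odd_perm q *: gring_row (regular_repr F 'Sym_('I_n) (p * q)%g).

(* The Specht module of shape la, as a right ideal of the group algebra of    *)
(* S_n, and the associated representations of S_n and (by restriction) A_n.   *)
Definition specht_mx (F : fieldType) (n : nat) (la : seq nat) :
    'M[F]_#|'Sym_('I_n)| :=
  cyclic_mx (regular_repr F 'Sym_('I_n)) (young_symmetrizer F n la).

Definition specht_repr (F : fieldType) (n : nat) (la : seq nat) :
    mx_representation F 'Sym_('I_n) (\rank (specht_mx F n la)) :=
  submod_repr (cyclic_mx_module (regular_repr F 'Sym_('I_n))
                                (young_symmetrizer F n la)).

Definition D_dim (F : fieldType) (n : nat) (la : seq nat) : nat :=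
  \rank (specht_mx F n la).

Definition D_repr (F : fieldType) (n : nat) (la : seq nat) :
    mx_representation F 'Alt_('I_n) (D_dim F n la) :=
  subg_repr (specht_repr F n la) (Alt_subset 'I_n).

(* The type of isotypic components of the group algebra of A_n; an element    *)
(* W of this type coerces to a matrix whose row space is the component, and   *)
(* irr_repr W is the irreducible representation W is a multiple of.           *)
Definition irrAlt (F : decFieldType) (n : nat) : irrType F 'Alt_('I_n) :=
  DecSocleType (regular_repr F 'Alt_('I_n)).

(* Main.v *)
Require Import Defs.
From HB Require Import structures.
From mathcomp Require Import all_boot all_order all_fingroup all_algebra.
From mathcomp Require Import all_solvable mxrepresentation.
From mathcomp Require Import complex reals.
From mathcomp Require Import zify ring.

(* Write P = s (L_{n-1} + L_n) with s = (n-1, n) and L_k the Jucys-Murphy     *)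
(* elements. On the Specht module the L_k act diagonally, the joint           *)
(* eigenvalues being the contents of the standard tableaux, each with         *)
(* multiplicity one: if r is the row symmetrizer and c the column             *)
(* antisymmetrizer, the vector r c r is a joint eigenvector by the Garnir     *)
(* relations, its eigenvalues are the contents of the row reading tableau,    *)
(* and admissible transpositions carry it to every other tableau (Okounkov    *)
(* and Vershik). Each pair {T, s T}, or single T with n-1 and n adjacent,     *)
(* then gives the eigenvalues of P directly. The restriction to A_n stays     *)
(* irreducible because an operator anticommuting with the odd permutations    *)
(* would send the contents of T to those of a tableau of the conjugate shape. *)
(* Finally an isotypic component of C[A_n] is the sum of d copies of its      *)
(* simple constituent, d being its dimension.                                 *)

(** Composing from left to right, (i,n-1,n) = s (i,n-1), (i,n,n-1) = s (i,n) and id = s s, which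
    gives the factorization of P ([Pelt_jm]). The sum L_{n-1} + L_n commutes with s and acts on the
    weight vector v_T by a_{n-1} + a_n. Hence v_T s + eps v_T with eps = 1 or -1 is fixed by s up to
    the sign eps, and P multiplies it by eps (a_{n-1} + a_n) ([eigvecP]). Choosing eps from the
    order of a_{n-1} and a_n gives one such vector per tableau, and these vectors span
    ([eigvec_span]).

    The v_T come from a single one: [specht_vec_jm] finds the weight of r c r, [specht_gen_uniq]
    shows that its weight space is a line, and [weight_vectors] carries both facts along admissible
    swaps. The span of the v_T is a submodule containing a generator ([v_span]), and vectors of
    distinct weights are orthogonal for an invariant form ([card_Std]).

    All permutations in P are even, so P is respected by A_n-isomorphisms. With [D_repr_irr] this
    moves the count from the Specht module to the isotypic component ([rank_eigenspace_component]).
    The count runs over Std(la), while the listed eigenvalues run over UStd(la) and UStd(la'):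
    [sum_mult_UStd2] trades the tableaux of shape la with c(T,2) = -1 for tableaux of shape la', and
    [sum_mult_Std] spreads the two eigenvalues of case (3) over T and s T. *)

Set Implicit Arguments.
Unset Strict Implicit.
Unset Printing Implicit Defensive.

Import Order.TTheory GRing.Theory Num.Theory.
Local Open Scope ring_scope.

(** * Sums of distinct naturals and conjugate partitions *)

Section InjectiveSums.
Local Open Scope nat_scope.

(** Remove the element of largest value: m + 1 distinct naturals cannot all lie below m, so this
    value is at least m, and it equals m when the total is minimal. This bound drives both the
    factorization of permutations by rows and columns and the Garnir relations. *)
Lemma bin2_le_inj_sum (T : finType) (B : {set T}) (c : T -> nat) :
    {in B &, injective c} ->
  'C(#|B|, 2) <= \sum_(x in B) c x /\
  ('C(#|B|, 2) = \sum_(x in B) c x -> {in B, forall x, c x < #|B|}).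
Proof.
move: {2}#|B| (erefl #|B|) => m; elim: m B => [|m IHm] B cardB injc.
  by move/cards0_eq: cardB => ->; rewrite cards0; split=> // _ x; rewrite inE.
have /card_gt0P [x0 Bx0] : 0 < #|B| by rewrite cardB.
pose x := [arg max_(i > x0 in B) c i].
have [Bx maxx] : x \in B /\ {in B, forall y, c y <= c x}.
  by rewrite /x; case: arg_maxnP => // i Bi Hi; split.
have cardB' : #|B :\ x| = m by move: (cardsD1 x B); rewrite Bx cardB => -[].
have injc' : {in B :\ x &, injective c}.
  by move=> y z /setD1P[_ By] /setD1P[_ Bz]; apply: injc.
have [le_m eq_m] := IHm _ cardB' injc'.
have cx : m <= c x.
  have: uniq [seq c y | y in B].
    by rewrite map_inj_in_uniq ?enum_uniq // => y z; rewrite !mem_enum; apply: injc.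
  move/uniq_leq_size => /(_ (iota 0 (c x).+1)).
  rewrite size_map size_iota -cardE cardB ltnS; apply=> _ /mapP[y By ->].
  by rewrite mem_iota ltnS maxx // -mem_enum.
rewrite cardB' in le_m eq_m.
rewrite (big_setD1 x Bx) /= cardB binS bin1; split; first lia.
move=> eqB y By; have := maxx y By; lia.
Qed.

Lemma inj_sum_bin2 (T : finType) (B : {set T}) (c : T -> nat) :
    {in B &, injective c} -> {in B, forall x, c x < #|B|} ->
  \sum_(x in B) c x = 'C(#|B|, 2).
Proof.
move=> injc ltc; rewrite -bin2_sum -[LHS]big_enum /=.
rewrite -(big_map c xpredT id) /index_iota subn0; apply: perm_big.
have Uc : uniq [seq c y | y in B].
  by rewrite map_inj_in_uniq ?enum_uniq // => y z; rewrite !mem_enum; apply: injc.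
have sub : {subset [seq c y | y in B] <= iota 0 #|B|}.
  by move=> _ /mapP[y By ->]; rewrite mem_iota ltc // -mem_enum.
by apply: uniq_perm (iota_uniq _ _) (uniq_min_size Uc sub _).2;
  rewrite // size_iota size_map -cardE.
Qed.

Lemma bin2_le_inj_block_sum (T I : finType) (f : T -> I) (c : T -> nat) :
    (forall x y, f x = f y -> c x = c y -> x = y) ->
  \sum_(i : I) 'C(#|[set x | f x == i]|, 2) <= \sum_x c x /\
  (\sum_(i : I) 'C(#|[set x | f x == i]|, 2) = \sum_x c x ->
   forall x, c x < #|[set y | f y == f x]|).
Proof.
move=> injc.
have sumE : \sum_x c x = \sum_i \sum_(x in [set x | f x == i]) c x.
  rewrite (partition_big f predT) //=; apply: eq_bigr => i _.
  by apply: eq_bigl => x; rewrite inE.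
have blk i := @bin2_le_inj_sum T [set x | f x == i] c.
have inji i : {in [set x | f x == i] &, injective c}.
  by move=> x y; rewrite !inE => /eqP fx /eqP fy; apply: injc; rewrite fx.
rewrite sumE; split=> [|eqs x].
  by apply: leq_sum => i _; have [] := blk i (inji i).
have [_ eqi] := blk (f x) (inji (f x)).
apply: eqi; last by rewrite inE.
have := @leqif_sum I xpredT
  (fun i => 'C(#|[set x | f x == i]|, 2) == \sum_(x in [set x | f x == i]) c x)
  (fun i => 'C(#|[set x | f x == i]|, 2))
  (fun i => \sum_(x in [set x | f x == i]) c x).
case=> [i _|_]; first by split=> //; have [] := blk i (inji i).
by rewrite eqs eqxx => /esym/forallP/(_ (f x))/eqP.
Qed.

End InjectiveSums.

Section Conjugation.
Local Open Scope nat_scope.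
Implicit Types la mu : seq nat.

Lemma partition_nth_eq la mu : 0 \notin la -> 0 \notin mu ->
  (forall i j, (j < nth 0 la i) = (j < nth 0 mu i)) -> la = mu.
Proof.
move=> la0 mu0 eq_lt.
have eq_nth i : nth 0 la i = nth 0 mu i.
  by apply/eqP; rewrite eqn_leq leqNgt eq_lt ltnn leqNgt -eq_lt ltnn.
have sz nu i : 0 \notin nu -> (i < size nu) = (0 < nth 0 nu i).
  move=> nu0; have [lt_i|?] := ltnP i (size nu); last by rewrite nth_default.
  by rewrite lt0n; apply/esym; apply: contraNneq nu0 => <-; apply: mem_nth.
suff sz_eq : size la = size mu by apply: (@eq_from_nth _ 0).
have [lt|lt|//] := ltngtP (size la) (size mu).
  by move: lt; rewrite sz // -eq_nth -sz // ltnn.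
by move: lt; rewrite sz // eq_nth -sz // ltnn.
Qed.

Lemma sorted_head_geq x la : sorted geq (x :: la) -> all (geq x) la.
Proof. by apply: order_path_min => y z w /= ? /leq_trans; apply. Qed.

Lemma count_gt_sorted la i j : sorted geq la ->
  (i < count (fun l => j < l) la) = (j < nth 0 la i).
Proof.
elim: la i => [|x la IHla] [|i] //= sla.
- have le_x := sorted_head_geq sla.
  have [//|le_xj] := ltnP j x; rewrite add0n; apply/negbTE; rewrite -leqNgt leqn0.
  rewrite -leqn0 leqNgt -has_count; apply/hasPn => y /(allP le_x) /= le_y.
  by rewrite -leqNgt (leq_trans le_y).
- have le_x := sorted_head_geq sla.
  rewrite -IHla ?(path_sorted sla) //; have [lt_jx|le_xj] := ltnP j x; first by rewrite add1n.
  have -> : count (fun l => j < l) la = 0; last by [].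
  apply/eqP; rewrite -leqn0 leqNgt -has_count; apply/hasPn => y /(allP le_x) /= le_y.
  by rewrite -leqNgt (leq_trans le_y).
Qed.

Lemma nth_conj la i j : sorted geq la ->
  (i < nth 0 (conj_partition la) j) = (j < nth 0 la i).
Proof.
move=> sla; rewrite -[RHS]count_gt_sorted // /conj_partition.
have [lt_j|le_j] := ltnP j (head 0 la); first by rewrite nth_mkseq.
rewrite nth_default ?size_mkseq // ltn0 count_gt_sorted //.
apply/esym/negbTE; rewrite -leqNgt; apply: leq_trans le_j.
case: la sla => [|x la] /=; first by rewrite nth_nil.
move=> sla; have le_x := sorted_head_geq sla.
case: i => [//|i] /=; have [lt_i|?] := ltnP i (size la); last by rewrite nth_default.
exact: (all_nthP 0 le_x).
Qed.

Lemma sorted_conj la : sorted geq la -> sorted geq (conj_partition la).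
Proof.
move=> sla; rewrite /conj_partition /mkseq.
apply: (@homo_sorted _ _ _ leq geq) (iota_sorted _ _) => x y /= le_xy.
by apply: sub_count => l; apply: leq_trans; rewrite ltnS.
Qed.

Lemma conj_neq0 la : sorted geq la -> 0 \notin conj_partition la.
Proof.
move=> sla; apply/mapP => -[j]; rewrite mem_iota add0n => /= lt_j /esym/eqP.
by rewrite -leqn0 leqNgt count_gt_sorted // nth0 lt_j.
Qed.

Lemma conj_partitionK la : sorted geq la -> 0 \notin la ->
  conj_partition (conj_partition la) = la.
Proof.
move=> sla la0; apply: partition_nth_eq => [||i j] //.
  exact/conj_neq0/sorted_conj.
by rewrite !nth_conj ?sorted_conj.
Qed.

Lemma nth_sorted_geq la i j : sorted geq la -> i <= j -> nth 0 la j <= nth 0 la i.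
Proof.
move=> sla le_ij; have [lt_j|?] := ltnP j (size la); last by rewrite nth_default.
have geq_trans : transitive geq by move=> x y z /= ? /leq_trans; apply.
have := sorted_leq_nth geq_trans (leqnn : reflexive geq) 0 sla; apply; rewrite // inE //.
exact: leq_ltn_trans lt_j.
Qed.

End Conjugation.

(** * Signed symmetrizers in the group algebra *)

Section Adjoint.
Variable F : numClosedFieldType.

Definition adjmx m n (A : 'M[F]_(m, n)) : 'M[F]_(n, m) := map_mx Num.conj A^T.

Lemma adjmxM m n p (A : 'M[F]_(m, n)) (B : 'M[F]_(n, p)) :
  adjmx (A *m B) = adjmx B *m adjmx A.
Proof. by rewrite /adjmx trmx_mul map_mxM. Qed.

Lemma adjmxK m n : cancel (@adjmx m n) (@adjmx n m).
Proof. by move=> A; apply/matrixP => i j; rewrite !mxE conjCK. Qed.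

Lemma adjmxZ m n a (A : 'M[F]_(m, n)) : adjmx (a *: A) = a^* *: adjmx A.
Proof. by apply/matrixP => i j; rewrite !mxE rmorphM. Qed.

Lemma adjmx_sum m n (I : Type) (r : seq I) (P : pred I) (E : I -> 'M[F]_(m, n)) :
  adjmx (\sum_(i <- r | P i) E i) = \sum_(i <- r | P i) adjmx (E i).
Proof. by rewrite /adjmx linear_sum /= raddf_sum. Qed.

(** The diagonal entries are sums of squared moduli. Products of self-adjoint symmetrizers are shown
    nonzero this way. *)
Lemma mulmx_adj_eq0 m n (A : 'M[F]_(m, n)) : A *m adjmx A = 0 -> A = 0.
Proof.
move=> A0; apply/matrixP => i j; rewrite mxE.
have /matrixP/(_ i i) := A0; rewrite !mxE => /eqP.
rewrite psumr_eq0 => [/allP/(_ j)|k _]; last first.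
  by rewrite !mxE -normCK exprn_ge0.
by rewrite mem_index_enum !mxE -normCK expf_eq0 normr_eq0 /= => /(_ isT)/eqP.
Qed.

End Adjoint.

Lemma in_Sym n (g : {perm 'I_n}) : g \in ('Sym_('I_n))%g.
Proof. by rewrite inE. Qed.
#[local] Hint Resolve in_Sym : core.

Section ColouringStabilizers.
Variables (n : nat) (I : eqType) (f : 'I_n -> I).

(** A Young subgroup: the row or column group when the colours are rows or columns. *)
Definition stabf : {set {perm 'I_n}} := [set s : {perm 'I_n} | [forall k, f (s k) == f k]].

Lemma stabfP (s : {perm 'I_n}) : reflect (forall k, f (s k) = f k) (s \in stabf).
Proof.
by rewrite inE; apply: (iffP forallP) => H k; apply/eqP; rewrite ?H // -(eqP (H k)).
Qed.

Lemma stabfM s t : s \in stabf -> t \in stabf -> (s * t)%g \in stabf.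
Proof. by move=> /stabfP Hs /stabfP Ht; apply/stabfP => k; rewrite permM Ht Hs. Qed.

Lemma stabfV s : (s^-1%g \in stabf) = (s \in stabf).
Proof.
suff H t : t \in stabf -> t^-1%g \in stabf.
  by apply/idP/idP => /H //; rewrite invgK.
by move=> /stabfP Hs; apply/stabfP => k; rewrite -(Hs (t^-1%g k)) permKV.
Qed.

Lemma stabf1 : 1%g \in stabf.
Proof. by apply/stabfP => k; rewrite perm1. Qed.

Lemma stabf_mull t s : t \in stabf -> ((t * s)%g \in stabf) = (s \in stabf).
Proof.
move=> Ht; apply/idP/idP => [Hts|]; last exact: stabfM.
by rewrite -(mulKg t s) stabfM ?stabfV.
Qed.

Lemma tperm_stabf i j : f i = f j -> tperm i j \in stabf.
Proof. by move=> fij; apply/stabfP => k; case: tpermP => // ->. Qed.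

(* Peel off the transposition (x, s x) for a moved x.                         *)
Lemma stabf_ind (P : {perm 'I_n} -> Prop) :
  P 1%g ->
  (forall s i j, s \in stabf -> f i = f j -> P s -> P (s * tperm i j)%g) ->
  forall s, s \in stabf -> P s.
Proof.
move=> P1 PM s; move: {2}#|_| (leqnn #|[set x | s x != x]|) => m.
elim: m s => [|m IHm] s le_m Hs.
  suff -> : s = 1%g by [].
  apply/permP => x; rewrite perm1; apply/eqP/negP => /negP sx.
  by move: le_m; rewrite leqNgt card_gt0; case/negP; apply/set0Pn; exists x; rewrite inE.
have [/eqP|/set0Pn[x]] := eqVneq [set x | s x != x] set0.
  by move=> s0; apply: IHm => //; rewrite (eqP s0) cards0.
rewrite inE => sx; have fsx := stabfP _ Hs x.
rewrite -[s](mulgKV (tperm x (s x))) tpermV; apply: PM => //.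
  by rewrite stabfM ?tperm_stabf.
apply: IHm; last by rewrite stabfM ?tperm_stabf.
rewrite -ltnS; apply: leq_trans le_m; apply: proper_card; apply/properP; split.
  apply/subsetP => y; rewrite !inE permM; apply: contra => /eqP sy; rewrite sy.
  rewrite tpermD //; first by apply: contra sx => /eqP ->; rewrite sy.
  by apply: contra sx => /eqP sxy; rewrite (perm_inj (etrans sxy (esym sy))) sy.
by exists x; rewrite !inE ?permM ?tpermR ?eqxx.
Qed.

End ColouringStabilizers.

Section SignedSums.
Local Open Scope group_scope.
Local Open Scope ring_scope.
Variables (F : numClosedFieldType) (n : nat).
Local Notation aG := (regular_repr F 'Sym_('I_n)).
Implicit Types (e : bool) (g : {perm 'I_n}).

(** The flag selects the trivial or the sign character, so that row symmetrizers ([false]) and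
    column antisymmetrizers ([true]) share one theory. *)
Definition sgnF e g : F := (-1) ^+ (e && odd_perm g).

Lemma sgnFM e g h : sgnF e (g * h)%g = sgnF e g * sgnF e h.
Proof. by rewrite /sgnF odd_permM; case: e => //=; rewrite ?signr_addb ?mulr1. Qed.

Lemma sgnFV e g : sgnF e g^-1%g = sgnF e g.
Proof. by rewrite /sgnF odd_permV. Qed.

Lemma sgnF_sqr e g : sgnF e g * sgnF e g = 1.
Proof. by rewrite -expr2 sqrr_sign. Qed.

Definition sgnsum (I : eqType) e (f : 'I_n -> I) : 'M[F]_#|'Sym_('I_n)| :=
  \sum_(s in stabf f) sgnF e s *: aG s.

Lemma aGM g h : aG (g * h)%g = aG g *m aG h.
Proof. by rewrite repr_mxM. Qed.

(** Permutation matrices are unitary. Conjugate transposition is thus the anti-involution inverting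
    group elements, and it turns left identities into right ones. *)
Lemma aG_adj g : adjmx (aG g) = aG g^-1%g.
Proof.
apply/matrixP => i j; rewrite !mxE eqxx /= conjC_nat; congr (_%:R).
pose G := 'Sym_('I_n); have GK x : enum_val (@gring_index _ G x) = x.
  exact: gring_indexK.
rewrite -!(inj_eq (@enum_val_inj _ (mem G))) !GK.
by rewrite eq_sym (can2_eq (mulgK _) (mulgKV _)) eq_sym.
Qed.

Lemma sgnsum_adj (I : eqType) e (f : 'I_n -> I) : adjmx (sgnsum e f) = sgnsum e f.
Proof.
rewrite /sgnsum adjmx_sum (reindex_inj invg_inj) /=.
apply: eq_big => [s|s _]; first by rewrite stabfV.
rewrite adjmxZ aG_adj invgK sgnFV; congr (_ *: _).
by rewrite /sgnF rmorph_sign.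
Qed.

Lemma sgnsum_mull (I : eqType) e (f : 'I_n -> I) t :
  t \in stabf f -> aG t *m sgnsum e f = sgnF e t *: sgnsum e f.
Proof.
move=> Ht; rewrite /sgnsum [in RHS](reindex_inj (mulgI t)) /=.
rewrite mulmx_sumr scaler_sumr.
apply: eq_big => [s|s Hs]; first by rewrite stabf_mull.
by rewrite -scalemxAr scalerA sgnFM mulrA sgnF_sqr mul1r aGM.
Qed.

Lemma sgnsum_mulr (I : eqType) e (f : 'I_n -> I) t :
  t \in stabf f -> sgnsum e f *m aG t = sgnF e t *: sgnsum e f.
Proof.
move=> Ht; apply: (can_inj (@adjmxK _ _ _)).
rewrite adjmxM aG_adj sgnsum_adj sgnsum_mull ?stabfV // adjmxZ sgnsum_adj sgnFV.
by rewrite /sgnF rmorph_sign.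
Qed.

Lemma sgnsum_sqr (I : eqType) e (f : 'I_n -> I) :
  sgnsum e f *m sgnsum e f = #|stabf f|%:R *: sgnsum e f.
Proof.
rewrite {1}/sgnsum mulmx_suml scaler_nat -sumr_const.
apply: eq_bigr => s Hs.
by rewrite -scalemxAl sgnsum_mull // scalerA sgnF_sqr scale1r.
Qed.

Lemma card_stabf_neq0 (I : eqType) (f : 'I_n -> I) : #|stabf f|%:R != 0 :> F.
Proof. by rewrite pnatr_eq0 -lt0n; apply/card_gt0P; exists 1%g; apply: stabf1. Qed.

Lemma tperm_conjV g i j : (g * tperm i j * g^-1)%g = tperm (g^-1 i)%g (g^-1 j)%g.
Proof. by rewrite -tpermJ conjgE invgK mulgA. Qed.

(** The transposition (i, j) is absorbed by the symmetrizer of [f]; moved to the left through [g],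
    it becomes a transposition of the group of [h] and contributes a sign -1. *)
Lemma sgnsum_collision (I J : eqType) (h : 'I_n -> J) (f : 'I_n -> I) g i j :
    i != j -> f i = f j -> h (g^-1 i)%g = h (g^-1 j)%g ->
  sgnsum true h *m aG g *m sgnsum false f = 0.
Proof.
move=> ij fij hij; set X := _ *m _ *m _.
have: X = - X; last first.
  move/eqP; rewrite -addr_eq0 -mulr2n -scaler_nat scaler_eq0 pnatr_eq0 /=.
  by move/eqP.
rewrite {1}/X -[sgnsum false f]scale1r -[1](_ : sgnF false (tperm i j) = 1) //.
rewrite -sgnsum_mull ?tperm_stabf // mulmxA -[_ *m aG g *m _]mulmxA -aGM.
rewrite -(mulgKV g (g * _)%g) tperm_conjV aGM mulmxA sgnsum_mulr ?tperm_stabf //.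
by rewrite /sgnF /= odd_tperm (inj_eq perm_inj) ij /= expr1 scaleN1r !mulNmx.
Qed.

(** Coset decomposition by the image of [k]; the colouring by pairs has the stabilizer of [k] as its
    group. *)
Lemma sgnsum_split (I : eqType) (f : 'I_n -> I) (k : 'I_n) :
  sgnsum false f =
    \sum_(i | f i == f k) sgnsum false (fun x => (f x, x == k)) *m aG (tperm i k).
Proof.
rewrite /sgnsum (partition_big (fun s : {perm 'I_n} => s k) (fun i => f i == f k)) /=;
  last by move=> s /stabfP ->.
apply: eq_bigr => i /eqP fik.
rewrite mulmx_suml (reindex_inj (mulIg (tperm i k))) /=.
apply: eq_big => [s|s _]; last by rewrite !scale1r aGM.
rewrite permM; apply/andP/stabfP => [[/stabfP Hs /eqP sk] x|Hs].
  have skk : s k = k by rewrite -[s k](tpermK i k) sk tpermL.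
  congr (_, _); last by rewrite -{1}skk (inj_eq perm_inj).
  by rewrite -[RHS]Hs permM; case: tpermP => // ->.
have skk : s k = k by have [_ E] := Hs k; apply/eqP; rewrite E.
split; last by rewrite skk tpermR.
by apply/stabfP => x; rewrite permM; have [<- _] := Hs x; case: tpermP => // ->.
Qed.

End SignedSums.

(** * The row reading of a partition and the Garnir relations *)

Section RowReading.
Local Open Scope nat_scope.
Variables (n : nat) (la : seq nat).
Hypothesis la_part : is_partition n la.

Lemma part_sorted : sorted geq la.
Proof. by case/and3P: la_part. Qed.

Lemma part_neq0 : 0%N \notin la.
Proof. by case/and3P: la_part. Qed.

Lemma sumn_part : sumn la = n.
Proof. by case/and3P: la_part => _ _ /eqP. Qed.

Lemma ltn_sumn_part (k : 'I_n) : k < sumn la.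
Proof. by rewrite sumn_part. Qed.

(* Locked, lest simplification replace [rrow k] by its value everywhere.      *)
Fact rrow_key : unit. Proof. by []. Qed.
Definition rrow (k : 'I_n) : 'I_(size la) :=
  locked_with rrow_key (Ordinal (reshape_indexP (ltn_sumn_part k))).

Lemma val_rrow k : rrow k = reshape_index la k :> nat.
Proof. by rewrite /rrow unlock. Qed.

Definition rcol (k : 'I_n) : nat := reshape_offset la k.

Lemma rcol_lt k : rcol k < nth 0 la (rrow k).
Proof. by rewrite val_rrow reshape_offsetP ?ltn_sumn_part. Qed.

Lemma rcell_inj i j : rrow i = rrow j -> rcol i = rcol j -> i = j.
Proof.
rewrite /rcol => /(congr1 val)/=; rewrite !val_rrow => eqr eqc; apply: val_inj.
by rewrite /= -(reshape_indexK la i) -(reshape_indexK la j) eqr eqc.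
Qed.

Lemma rcell_subproof (r : 'I_(size la)) c :
  c < nth 0 la r -> flatten_index la r c < n.
Proof. by move=> /flatten_indexP; rewrite sumn_part. Qed.

Definition rcell r c lt_c : 'I_n := Ordinal (@rcell_subproof r c lt_c).

Lemma rcellP (r : 'I_(size la)) c (lt_c : c < nth 0 la r) :
  rrow (rcell lt_c) = r /\ rcol (rcell lt_c) = c.
Proof.
split; last exact: flatten_indexKr.
by apply: val_inj; rewrite /= val_rrow flatten_indexKl.
Qed.

Lemma card_rrow (r : 'I_(size la)) : #|[set k | rrow k == r]| = nth 0 la r.
Proof.
rewrite -[RHS]card_ord.
pose f (c : 'I_(nth 0 la r)) : 'I_n := rcell (ltn_ord c).
have fP c : rrow (f c) = r /\ rcol (f c) = c.
  exact: rcellP.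
have injf : injective f.
  move=> c d efcd; apply: val_inj; have [_ /= <-] := fP c.
  by rewrite efcd; have [_ ->] := fP d.
rewrite -(card_imset _ injf); apply: eq_card => k; rewrite inE.
apply/eqP/imsetP => [rk|[c _ ->]]; last by have [] := fP c.
have ltc := rcol_lt k; rewrite rk in ltc; exists (Ordinal ltc) => //.
by have [? ?] := fP (Ordinal ltc); apply: rcell_inj; rewrite ?rk.
Qed.

Lemma sum_rcol : \sum_k rcol k = \sum_(r < size la) 'C(nth 0 la r, 2).
Proof.
rewrite (partition_big rrow predT) //=; apply: eq_bigr => r _.
rewrite -[in RHS]card_rrow -(@inj_sum_bin2 _ [set k | rrow k == r] rcol).
- by apply: eq_bigl => k; rewrite inE.
- by move=> i j; rewrite !inE => /eqP ri /eqP rj; apply: rcell_inj; rewrite ri.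
by move=> k; rewrite inE card_rrow => /eqP <-; apply: rcol_lt.
Qed.

(* If g spreads every row over distinct columns, the sum of the column        *)
(* indices is minimal in each row, so each row is rearranged within itself.   *)
Lemma rrow_rcol_factor (g : {perm 'I_n}) :
    (forall i j, rrow i = rrow j -> rcol (g^-1 i)%g = rcol (g^-1 j)%g -> i = j) ->
  exists q p, [/\ q \in stabf rcol, p \in stabf rrow & g = (q * p)%g].
Proof.
move=> inj_g; have [_ eq_lt] := bin2_le_inj_block_sum inj_g.
have {eq_lt} lt_row x : rcol (g^-1 x)%g < nth 0 la (rrow x).
  rewrite -card_rrow; apply: eq_lt.
  rewrite [RHS](reindex_inj (@perm_inj _ g)) /=.
  under [RHS]eq_bigr do rewrite permK.
  by rewrite sum_rcol; apply: eq_bigr => r _; rewrite card_rrow.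
(* [p0] sends i to the box of its own row lying in the column of g^-1 i, which exists by
   [lt_row]. *)
pose p0 i := rcell (lt_row i).
have p0P i : rrow (p0 i) = rrow i /\ rcol (p0 i) = rcol (g^-1 i)%g.
  exact: rcellP.
have injp : injective p0.
  move=> i j eij; have [ri ci] := p0P i; have [rj cj] := p0P j.
  by apply: inj_g; rewrite -?ri -?ci eij.
exists (g * perm injp)%g, (perm injp)^-1%g; split; last by rewrite mulgK.
  by apply/stabfP => k; rewrite permM permE; have [_ ->] := p0P (g k); rewrite permK.
by rewrite stabfV; apply/stabfP => k; rewrite permE; have [] := p0P k.
Qed.

Variable F : numClosedFieldType.
Local Open Scope group_scope.
Local Open Scope ring_scope.
Local Notation aG := (regular_repr F 'Sym_('I_n)).
Local Notation P := (sgnsum F false rrow).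
Local Notation Q := (sgnsum F true rcol).

(** Von Neumann's lemma: a permutation either puts two elements of a row into one column and
    contributes 0, or factors as q p, whose factors are absorbed up to sign. *)
Lemma col_row_sandwich (A : 'M_#|'Sym_('I_n)|) :
    (A \in enveloping_algebra_mx aG)%MS ->
  exists c, Q *m A *m P = c *: (Q *m P).
Proof.
have QgP g : exists c, Q *m aG g *m P = c *: (Q *m P).
  have [/forallP inj_g|] := boolP [forall i, forall j,
    (rrow i == rrow j) ==> (rcol (g^-1 i)%g == rcol (g^-1 j)%g) ==> (i == j)].
    have [|q [p [Qq Pp ->]]] := @rrow_rcol_factor g.
      move=> i j rij cij; apply/eqP.
      by move/forallP/(_ j): (inj_g i); rewrite rij cij !eqxx.
    exists (sgnF F true q); rewrite aGM mulmxA sgnsum_mulr // -!scalemxAl -mulmxA.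
    by rewrite sgnsum_mull // scale1r.
  case/forallPn => i /forallPn [j].
  rewrite !negb_imply => /and3P[/eqP rij /eqP cij ij]; exists 0.
  by rewrite scale0r (sgnsum_collision _ ij rij cij).
case/envelop_mxP => a ->; move: QgP; move: (Q) (P) => Q0 P0 QgP.
rewrite mulmx_sumr mulmx_suml.
elim/big_rec: _ => [|g M _ [c ->]]; first by exists 0; rewrite scale0r.
have [d Hd] := QgP g; exists (a g * d + c).
by rewrite -scalemxAr -scalemxAl Hd scalerA scalerDl.
Qed.

(* The sum is, up to a left factor, the symmetrizer of the rows obtained by   *)
(* moving k up to row r. The sum of the binomials of the row lengths then     *)
(* exceeds the sum of the column indices, so some row meets a column twice.   *)
Lemma garnir_relation (k : 'I_n) (r : 'I_(size la)) :
    (r < rrow k)%N ->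
  Q *m P *m (1%:M + \sum_(i | rrow i == r) aG (tperm i k)) = 0.
Proof.
move=> lt_r; pose f x := if x == k then r else rrow x.
have nrk : rrow k == r = false by apply/negbTE; rewrite neq_ltn lt_r orbT.
have -> : P = \sum_(i | rrow i == rrow k)
    aG (tperm i k) *m sgnsum F false (fun x => (rrow x, x == k)).
  rewrite -[LHS]sgnsum_adj (sgnsum_split _ _ k) adjmx_sum.
  by apply: eq_bigr => i _; rewrite adjmxM aG_adj sgnsum_adj tpermV.
(* Split by the image of [k]: the image [k] gives the identity, the images in row [r] give the
   transpositions. *)
have defS : sgnsum F false f = sgnsum F false (fun x => (rrow x, x == k)) *m
    (1%:M + \sum_(i | rrow i == r) aG (tperm i k)).
  rewrite (sgnsum_split _ _ k) {2}/f eqxx (bigD1 k) /=; last by rewrite /f eqxx.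
  rewrite tperm1 repr_mx1 mulmx1 mulmxDr mulmx1 mulmx_sumr.
  have -> : sgnsum F false (fun x => (f x, x == k)) =
            sgnsum F false (fun x => (rrow x, x == k)).
    apply: eq_bigl => s; apply/stabfP/stabfP => Hs x.
      have /(congr1 snd)/= skk := Hs k; rewrite eqxx in skk.
      have /(congr1 fst)/= := Hs x; have /(congr1 snd)/= -> := Hs x.
      by rewrite /f; case: (eqVneq x k) (congr1 snd (Hs x)) => /= [-> _ _|_ -> ->];
        rewrite ?(eqP skk).
    have /(congr1 fst)/= sx := Hs x; have /(congr1 snd)/= sk := Hs x.
    by rewrite /f sk sx.
  congr (_ + _); apply: eq_bigl => i; rewrite /f.
  by case: (eqVneq i k) => [->|_]; rewrite ?andbF ?nrk ?andbT.
rewrite mulmx_sumr mulmx_suml big1 // => g0 _.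
rewrite mulmxA -mulmxA -defS; set g := tperm _ _.
have [/existsP[i /existsP[j /and3P[ij /eqP fij /eqP cij]]]|] :=
    boolP [exists i, exists j,
      [&& i != j, f i == f j & rcol (g^-1 i)%g == rcol (g^-1 j)%g]].
  exact: sgnsum_collision ij fij cij.
rewrite negb_exists => /forallP noc.
have inj_g i j : f i = f j -> rcol (g^-1 i)%g = rcol (g^-1 j)%g -> i = j.
  move=> fij cij; move: (noc i); rewrite negb_exists => /forallP/(_ j).
  by rewrite fij cij !eqxx !andbT negbK => /eqP.
have [le_sum _] := bin2_le_inj_block_sum inj_g.
suff: (\sum_x rcol (g^-1 x)%g < \sum_i 'C(#|[set x | f x == i]|, 2))%N.
  by rewrite ltnNge le_sum.
rewrite [ltnLHS](reindex_inj (@perm_inj _ g)) /=.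
under [ltnLHS]eq_bigr do rewrite permK.
rewrite sum_rcol (bigD1 r) // (bigD1 (rrow k)) /=; last by rewrite nrk.
rewrite [ltnRHS](bigD1 r) // [X in (_ < _ + X)%N](bigD1 (rrow k)) /=; last by rewrite nrk.
have -> : (\sum_(i < size la | (i != r) && (i != rrow k))
      'C(#|[set x | f x == i]|, 2) =
    \sum_(i < size la | (i != r) && (i != rrow k)) 'C(nth 0%N la i, 2))%N.
  apply: eq_bigr => i /andP[ir ik]; rewrite -card_rrow; congr 'C(_, 2).
  apply: eq_card => x; rewrite !inE /f; case: (eqVneq x k) => [->|//].
  by rewrite !(eq_sym _ i) (negbTE ir) (negbTE ik).
have -> : #|[set x | f x == r]| = (nth 0%N la r).+1.
  rewrite -card_rrow -[RHS](_ : #|k |: [set x | rrow x == r]| = _); last first.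
    by rewrite cardsU1 inE nrk.
  by apply: eq_card => x; rewrite !inE /f; case: (eqVneq x k) => [->|//]; rewrite eqxx.
have cardk : #|[set x | f x == rrow k]|.+1 = nth 0%N la (rrow k).
  rewrite -card_rrow [RHS](cardsD1 k) inE eqxx; congr _.+1.
  apply: eq_card => x; rewrite !inE /f; case: (eqVneq x k) => [->|//].
  by rewrite eq_sym nrk.
(* With p the length of row r and m + 1 <= p that of the row of k, moving the box changes C(p,2) +
   C(m+1,2) by p - m > 0. *)
have := nth_sorted_geq part_sorted (ltnW lt_r); rewrite -cardk !binS !bin1.
set x := (\sum_(_ < _ | _) _)%N; set m := #|_|; set p := nth _ _ _.
by move: m p x 'C(m, 2) 'C(p, 2); lia.
Qed.

End RowReading.

(** * Jucys-Murphy weights *)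

Section JucysMurphy.
Local Open Scope group_scope.
Local Open Scope ring_scope.
Variables (F : fieldType) (n d : nat) (rG : mx_representation F 'Sym_('I_n) d).

Definition jm (k : 'I_n) : 'M[F]_d := \sum_(i : 'I_n | (i < k)%N) rG (tperm i k).

End JucysMurphy.

(** * The vector r c r of the Specht module and its Jucys-Murphy eigenvalues *)

Section SpechtVector.
Local Open Scope group_scope.
Local Open Scope ring_scope.
Variables (F : numClosedFieldType) (n : nat) (la : seq nat).
Hypothesis la_part : is_partition n la.
Local Notation aG := (regular_repr F 'Sym_('I_n)).
Local Notation E_G := (enveloping_algebra_mx aG).
Local Notation rrow := (rrow la_part).
Local Notation rcol := (@rcol n la).
Local Notation P := (sgnsum F false rrow).
Local Notation Q := (sgnsum F true rcol).

Lemma young_symmetrizerE : young_symmetrizer F n la = gring_row (P *m Q).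
Proof.
rewrite /young_symmetrizer [in RHS]/sgnsum mulmx_suml linear_sum /=.
have -> : row_stabilizer n la = stabf rrow.
  apply/setP => s; rewrite !inE; apply: eq_forallb => k.
  by rewrite -[RHS](inj_eq val_inj) /= !val_rrow.
apply: eq_bigr => p _; rewrite -scalemxAl scale1r mulmx_sumr linear_sum /=.
by apply: eq_bigr => q _; rewrite -scalemxAr linearZ /= aGM.
Qed.

Lemma sgnsum_envelop (I : eqType) e (f : 'I_n -> I) : (sgnsum F e f \in E_G)%MS.
Proof.
rewrite /sgnsum linear_sum summx_sub // => s _.
by rewrite linearZ scalemx_sub // envelop_mx_id.
Qed.
Local Hint Resolve sgnsum_envelop : core.

Lemma gring_row_inj A : (A \in E_G)%MS -> gring_row A = 0 -> A = 0.
Proof. by move=> EA A0; rewrite -(gring_rowK EA) A0 linear0. Qed.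

Lemma gring_row_unit_coef g :
  gring_row (aG g) 0 (gring_index 'Sym_('I_n) 1%g) = (g == 1%g)%:R :> F.
Proof.
rewrite !mxE eqxx /= -(inj_eq (@enum_val_inj _ (mem 'Sym_('I_n)))).
by rewrite !gring_indexK // mul1g eq_sym.
Qed.

(** The identity has coefficient 1: p q = 1 puts q in both the row and the column group, which meet
    trivially. *)
Lemma row_col_sum_neq0 : P *m Q != 0.
Proof.
apply/eqP => /(congr1 (fun M => gring_row M 0 (gring_index 'Sym_('I_n) 1%g))).
apply/eqP; rewrite linear0 [X in _ != X]mxE [in P]/sgnsum mulmx_suml linear_sum summxE.
rewrite (bigD1 1%g) ?stabf1 //= big1 ?addr0 => [|p /andP[Pp p1]].
  rewrite scale1r repr_mx1 mul1mx [in Q]/sgnsum linear_sum summxE.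
  rewrite (bigD1 1%g) ?stabf1 //= big1 ?addr0 => [|q /andP[_ /negbTE q1]].
    by rewrite linearZ mxE gring_row_unit_coef eqxx mulr1 /sgnF odd_perm1 oner_eq0.
  by rewrite linearZ mxE gring_row_unit_coef q1 mulr0.
rewrite scale1r [in Q]/sgnsum mulmx_sumr linear_sum summxE big1 // => q Qq.
rewrite -scalemxAr linearZ mxE -aGM gring_row_unit_coef.
have [pq1|] := eqVneq (p * q)%g 1%g; last by rewrite mulr0.
case/eqP: p1; have Pq : q \in stabf rrow.
  by rewrite -[q]mul1g -(mulVg p) -mulgA pq1 mulg1 stabfV.
suff q1 : q = 1%g by rewrite -pq1 q1 mulg1.
apply/permP => k; rewrite perm1; apply: (@rcell_inj _ _ la_part).
  exact: (stabfP _ _ Pq).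
exact: (stabfP _ _ Qq).
Qed.

(** P Q times its adjoint is P Q Q P, a nonzero multiple of P Q P. *)
Lemma row_col_row_neq0 : P *m Q *m P != 0.
Proof.
apply: contraNneq row_col_sum_neq0 => PQP0.
apply/eqP/mulmx_adj_eq0; rewrite adjmxM !sgnsum_adj mulmxA -(mulmxA P) sgnsum_sqr.
by rewrite -scalemxAr -scalemxAl PQP0 scaler0.
Qed.

(** The scalar comes from the sandwich lemma. Were it 0, P Q P times its adjoint, a multiple of P Q
    P Q P, would vanish. *)
Lemma young_sqr : exists2 c, c != 0 & P *m Q *m P *m Q = c *: (P *m Q).
Proof.
have [c Hc] := col_row_sandwich la_part (envelop_mxM (sgnsum_envelop false rrow)
  (sgnsum_envelop true rcol)).
have Hc' : P *m Q *m P *m Q = c^* *: (P *m Q).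
  by have := congr1 (@adjmx F _ _) Hc; rewrite adjmxZ !adjmxM !sgnsum_adj !mulmxA.
exists c^* => //; apply: contraNneq row_col_row_neq0 => c0.
apply/eqP/mulmx_adj_eq0; rewrite !adjmxM !sgnsum_adj !mulmxA -(mulmxA _ P P).
by rewrite sgnsum_sqr -scalemxAr -!scalemxAl Hc' c0 scale0r mul0mx scaler0.
Qed.

(** The extra factor on the right makes the Young symmetrizer invariant under the row group, as an
    eigenvector of the Jucys-Murphy elements for the row reading must be. *)
Definition specht_vec : 'rV[F]_#|'Sym_('I_n)| := young_symmetrizer F n la *m P.

Lemma specht_vecE : specht_vec = gring_row (P *m Q *m P).
Proof.
have -> : specht_vec = gring_row (P *m Q) *m P by rewrite -young_symmetrizerE.
by rewrite -gring_row_mul.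
Qed.

Lemma specht_vec_neq0 : specht_vec != 0.
Proof.
rewrite specht_vecE; apply: contra_neq row_col_row_neq0.
move=> v0; apply: (gring_row_inj _ v0).
by do 2!apply: envelop_mxM => //; apply: sgnsum_envelop.
Qed.

Lemma specht_vec_sub : (specht_vec <= specht_mx F n la)%MS.
Proof. by apply/cyclic_mxP; exists P. Qed.

(** By [young_sqr], multiplying P Q P by Q returns a nonzero multiple of P Q, so [specht_vec] still
    generates. *)
Lemma young_sub_cyclic : (young_symmetrizer F n la <= cyclic_mx aG specht_vec)%MS.
Proof.
have [c c0 Hc] := young_sqr; apply/cyclic_mxP; exists (c^-1 *: Q).
  by rewrite linearZ scalemx_sub ?sgnsum_envelop.
rewrite specht_vecE -scalemxAr -gring_row_mul Hc linearZ scalerA mulVf //.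
by rewrite scale1r young_symmetrizerE.
Qed.

Lemma specht_vec_uniq A : (A \in E_G)%MS ->
  exists c, young_symmetrizer F n la *m A *m P = c *: specht_vec.
Proof.
move=> EA; have [c Hc] := col_row_sandwich la_part EA; exists c.
rewrite young_symmetrizerE specht_vecE -!gring_row_mul -linearZ.
by rewrite -!mulmxA (mulmxA Q) Hc -scalemxAr.
Qed.

Lemma rrow_ltn (i k : 'I_n) :
  (i < k)%N = (rrow i < rrow k)%N || ((rrow i == rrow k) && (rcol i < rcol k)%N).
Proof.
rewrite ltnNge (reshape_leq la) -(inj_eq val_inj) /= !val_rrow /rcol.
by case: ltngtP => //= _; rewrite -ltnNge.
Qed.

Lemma card_rcol_lt (k : 'I_n) :
  #|[set i | (rrow i == rrow k) && (rcol i < rcol k)%N]| = rcol k.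
Proof.
rewrite -[RHS]card_ord.
have lt_la (c : 'I_(rcol k)) : (c < nth 0%N la (rrow k))%N.
  exact: ltn_trans (ltn_ord c) (rcol_lt _ _).
pose f c := rcell la_part (lt_la c).
have fP c : rrow (f c) = rrow k /\ rcol (f c) = c by apply: rcellP.
have injf : injective f.
  move=> c d efcd; apply: val_inj; have [_ /= <-] := fP c.
  by rewrite efcd; have [_ ->] := fP d.
rewrite -(card_imset _ injf); apply: eq_card => i; rewrite inE.
apply/andP/imsetP => [[/eqP ri lt_i]|[c _ ->]]; last first.
  by have [-> ->] := fP c; rewrite eqxx.
exists (Ordinal lt_i) => //; have [? ?] := fP (Ordinal lt_i).
by apply: (@rcell_inj _ _ la_part); rewrite ?ri.
Qed.

(** Each earlier box of the same row gives a transposition fixing the vector, [rcol k] in all. Each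
    of the [rrow k] rows above contributes -1 by its Garnir relation. *)
Lemma specht_vec_jm (k : 'I_n) :
  specht_vec *m jm aG k = ((rcol k)%:R - (rrow k)%:R) *: specht_vec.
Proof.
rewrite /jm mulmx_sumr (eq_bigl _ _ (fun i => rrow_ltn i k)).
rewrite (bigID (fun i => rrow i == rrow k)) /= scalerBl; congr (_ + _).
  rewrite (eq_bigl (mem [set i | (rrow i == rrow k) && (rcol i < rcol k)%N])).
    rewrite (eq_bigr (fun=> specht_vec)) ?sumr_const ?card_rcol_lt ?scaler_nat //.
    move=> i; rewrite /= inE => /andP[/eqP ri _].
    by rewrite /specht_vec -mulmxA sgnsum_mulr ?scale1r // tperm_stabf.
  move=> i; rewrite !inE; case: (eqVneq (rrow i) (rrow k)) => [->|]; rewrite ?ltnn ?andbT //.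
  by rewrite andbF.
rewrite (eq_bigl (fun i => (rrow i < rrow k)%N)); last first.
  move=> i; case: (eqVneq (rrow i) (rrow k)) => [->|]; rewrite ?ltnn ?andbF ?andbT //.
  by rewrite orbF.
rewrite (partition_big rrow (fun r => (r < rrow k)%N)) //=.
rewrite (eq_bigr (fun=> - specht_vec)) => [|r lt_r].
  rewrite sumr_const scaler_nat mulNrn; congr (- (_ *+ _)).
  rewrite -[RHS]card_ord.
  have le_la : (rrow k <= size la)%N by exact: ltnW.
  have inj_w : injective (widen_ord le_la).
    by move=> i j /(congr1 val) /= ?; apply: val_inj.
  rewrite -(card_imset _ inj_w); apply: eq_card => r.
  apply/idP/imsetP => [lt_r|[r' _ ->]]; last exact: ltn_ord r'.
  by exists (Ordinal lt_r) => //; apply: val_inj.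
have /(congr1 (fun M => gring_row (P *m M))) := garnir_relation F lt_r.
rewrite mulmx0 linear0 !mulmxA mulmxDr mulmx1 linearD /= -specht_vecE => /eqP.
rewrite addrC addr_eq0 gring_row_mul -specht_vecE mulmx_sumr => /eqP <-.
by apply: eq_bigl => i; case: eqP => [->|]; rewrite ?lt_r ?andbF.
Qed.

End SpechtVector.

(** * Weights, an invariant Hermitian form, and adjacent transpositions *)

Section Weights.
Local Open Scope group_scope.
Local Open Scope ring_scope.
Variables (F : numClosedFieldType) (n d : nat).
Variable rG : mx_representation F 'Sym_('I_n) d.
Implicit Types (u v w : 'rV[F]_d) (g h : {perm 'I_n}).

Lemma rSymM g h : rG (g * h)%g = rG g *m rG h.
Proof. by rewrite repr_mxM. Qed.

Lemma rSym_tpermK i j m (A : 'M_(m, d)) : A *m rG (tperm i j) *m rG (tperm i j) = A.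
Proof. by rewrite -mulmxA -rSymM tperm2 repr_mx1 mulmx1. Qed.

(** Averaging makes the form invariant, so transpositions, being involutions, are self-adjoint. The
    Jucys-Murphy elements are then self-adjoint too, and distinct weights are orthogonal. *)
Definition hform u v : F := \sum_g (u *m rG g *m adjmx (v *m rG g)) 0 0.

Lemma hform_invariant g u v : hform (u *m rG g) (v *m rG g) = hform u v.
Proof.
rewrite /hform [RHS](reindex_inj (mulgI g)) /=.
by apply: eq_bigr => h _; rewrite !rSymM !mulmxA.
Qed.

Lemma hformDl u v w : hform (u + v) w = hform u w + hform v w.
Proof.
by rewrite /hform -big_split; apply: eq_bigr => g _; rewrite !mulmxDl mxE.
Qed.

Lemma hformZl a u v : hform (a *: u) v = a * hform u v.
Proof.
by rewrite /hform mulr_sumr; apply: eq_bigr => g _; rewrite -!scalemxAl mxE.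
Qed.

Lemma hformC u v : hform v u = (hform u v)^*.
Proof.
rewrite /hform rmorph_sum; apply: eq_bigr => g _ /=.
rewrite -[v *m rG g in LHS]adjmxK -adjmxM.
by rewrite !mxE.
Qed.

Lemma hform0l v : hform 0 v = 0.
Proof. by rewrite -(scale0r 0) hformZl mul0r. Qed.

Lemma hformDr u v w : hform w (u + v) = hform w u + hform w v.
Proof. by rewrite hformC hformDl rmorphD /= -!hformC. Qed.

Lemma hformZr a u v : hform v (a *: u) = a^* * hform v u.
Proof. by rewrite hformC hformZl rmorphM /= -hformC. Qed.

Lemma hform_suml (I : finType) (P : pred I) (E : I -> 'rV[F]_d) v :
  hform (\sum_(i | P i) E i) v = \sum_(i | P i) hform (E i) v.
Proof.
by apply: (big_morph (hform^~ v)) => [u w|]; rewrite ?hform0l // hformDl.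
Qed.

Lemma hform_term_ge0 u g : 0 <= (u *m rG g *m adjmx (u *m rG g)) 0 0.
Proof.
by rewrite mxE sumr_ge0 // => i _; rewrite !mxE -normCK exprn_ge0.
Qed.

Lemma hform_eq0 u : (hform u u == 0) = (u == 0).
Proof.
apply/eqP/eqP => [|->]; last by rewrite hform0l.
move/eqP; rewrite psumr_eq0 => [/allP/(_ 1%g)|g _]; last exact: hform_term_ge0.
rewrite mem_index_enum repr_mx1 mulmx1 => /(_ isT)/= /eqP uu0.
by apply: mulmx_adj_eq0; rewrite [LHS]mx11_scalar uu0 raddf0.
Qed.

Lemma hform_tperm i j u v : hform (u *m rG (tperm i j)) v = hform u (v *m rG (tperm i j)).
Proof. by rewrite -(hform_invariant (tperm i j)) rSym_tpermK. Qed.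

Lemma hform_jm k u v : hform (u *m jm rG k) v = hform u (v *m jm rG k).
Proof.
rewrite /jm !mulmx_sumr hform_suml hformC hform_suml rmorph_sum /=.
by apply: eq_bigr => i _; rewrite -hformC hform_tperm.
Qed.

Definition weight (a : 'I_n -> int) u := forall k, u *m jm rG k = (a k)%:~R *: u.

Lemma weight_orthogonal a b k u v :
  weight a u -> weight b v -> a k != b k -> hform u v = 0.
Proof.
move=> ua vb ab; have := hform_jm k u v; rewrite ua vb hformZl hformZr rmorph_int.
move/eqP; rewrite -subr_eq0 -mulrBl mulf_eq0 -rmorphB intr_eq0 subr_eq0.
by rewrite (negbTE ab) => /eqP.
Qed.

Section Adjacent.
Variables (i j : 'I_n).
Hypothesis adj_ij : j = i.+1 :> nat.
Local Notation s := (tperm i j).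

Lemma jm_tperm_comm k : k != i -> k != j -> rG s *m jm rG k = jm rG k *m rG s.
Proof.
move=> ki kj; rewrite /jm mulmx_sumr mulmx_suml (reindex_inj (@perm_inj _ s)) /=.
apply: eq_big => [x|x _].
  have ki' : k <> i :> nat by move/val_inj/eqP; rewrite (negbTE ki).
  have kj' : k <> j :> nat by move/val_inj/eqP; rewrite (negbTE kj).
  by case: tpermP => [->|->|//]; lia.
rewrite -!rSymM; congr (rG _).
have -> : tperm (s x) k = (tperm x k ^ s)%g by rewrite tpermJ [s k]tpermD // eq_sym.
by rewrite conjgE tpermV !mulgA tperm2 mul1g.
Qed.

(** Conjugation by s carries L_i to L_j without its term s; that term gives s s = 1. *)
Lemma jm_tperm_adj : rG s *m jm rG j = jm rG i *m rG s + 1%:M.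
Proof.
have ij : i != j by apply/eqP => e; move: adj_ij; rewrite e; lia.
rewrite /jm mulmx_sumr mulmx_suml (bigD1 i) /=; last by rewrite adj_ij.
rewrite -rSymM tperm2 repr_mx1 addrC; congr (_ + _).
apply: eq_big => [x|x /andP[lt_x xi]].
  rewrite adj_ij ltnS -(inj_eq val_inj) /=; lia.
rewrite -!rSymM; congr (rG _).
have xj : x != j by apply/eqP => e; move: lt_x; rewrite e; lia.
have -> : tperm x j = (tperm x i ^ s)%g.
  by rewrite tpermJ tpermL [s x]tpermD // eq_sym.
by rewrite conjgE tpermV !mulgA tperm2 mul1g.
Qed.

Lemma jm_adj_tperm : jm rG j *m rG s = rG s *m jm rG i + 1%:M.
Proof.
have /(congr1 (fun M => rG s *m M *m rG s)) := jm_tperm_adj.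
rewrite !mulmxA -rSymM tperm2 repr_mx1 mul1mx => ->.
by rewrite mulmxDr mulmxDl mulmx1 -rSymM tperm2 repr_mx1 !mulmxA rSym_tpermK.
Qed.

Variables (a : 'I_n -> int) (u : 'rV[F]_d).
Hypothesis ua : weight a u.

(** Young's seminormal form: the multiple of [u] is chosen so that the difference has the weight
    with a_i and a_j exchanged. *)
Definition swapvec := u *m rG s - ((a j)%:~R - (a i)%:~R)^-1 *: u.

Lemma weight_swap : a i != a j -> weight (fun k => a (s k)) swapvec.
Proof.
move=> aij k.
have aij0 : (a j)%:~R - (a i)%:~R != 0 :> F by rewrite -rmorphB intr_eq0 subr_eq0 eq_sym.
have us_j : u *m rG s *m jm rG j = (a i)%:~R *: (u *m rG s) + u.
  by rewrite -mulmxA jm_tperm_adj mulmxDr mulmx1 mulmxA ua scalemxAl.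
have us_i : u *m rG s *m jm rG i = (a j)%:~R *: (u *m rG s) - u.
  by rewrite scalemxAl -ua -[u *m _ *m rG s]mulmxA jm_adj_tperm mulmxDr mulmx1 mulmxA addrK.
rewrite /swapvec mulmxBl -scalemxAl ua.
have [->|ki] := eqVneq k i.
  rewrite tpermL us_i scalerBr !scalerA -addrA -opprD; congr (_ - _).
  rewrite -[in LHS](scale1r u) scalerA -scalerDl; congr (_ *: _); field.
  by [].
have [->|kj] := eqVneq k j.
  rewrite tpermR us_j scalerBr !scalerA -addrA; congr (_ + _).
  rewrite -[X in X - _](scale1r u) -scalerBl -scaleNr; congr (_ *: _); field.
  by [].
rewrite tpermD 1?eq_sym // -mulmxA jm_tperm_comm // mulmxA ua scalerBr.
by rewrite -scalemxAl !scalerA mulrC.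
Qed.

Lemma swapvec_tperm :
  u *m rG s = ((a j)%:~R - (a i)%:~R)^-1 *: u + swapvec.
Proof. by rewrite /swapvec addrC subrK. Qed.

(* The invariant form makes [u] and [swapvec] orthogonal and [s] unitary, so  *)
(* when the coefficient of [u] in [u s] is a sign, [swapvec] must vanish.     *)
Lemma swapvec_eq0 (b : bool) : a j - a i = (-1) ^+ b -> swapvec = 0.
Proof.
move=> daij; have aij : a i != a j.
  by rewrite eq_sym -subr_eq0 daij signr_eq0.
have ortho : hform u swapvec = 0.
  apply: (@weight_orthogonal _ _ i _ _ ua (weight_swap aij)).
  by rewrite tpermL.
move: ortho swapvec_tperm; move: swapvec => w ortho us.
have := hform_invariant s u u; rewrite us -rmorphB daij.
rewrite rmorph_sign !(hformDl, hformDr, hformZl, hformZr) fmorphV rmorph_sign.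
rewrite ortho [hform w u]hformC ortho rmorph0 !mulr0 addr0 add0r mulrA.
rewrite -invfM -expr2 sqrr_sign invr1 mul1r => /eqP.
by rewrite addrC -subr_eq0 addrK hform_eq0 => /eqP.
Qed.

Lemma weight_adj_sign (b : bool) : a j - a i = (-1) ^+ b -> u *m rG s = (-1) ^+ b *: u.
Proof.
move=> daij; rewrite swapvec_tperm (swapvec_eq0 daij) addr0 -rmorphB daij.
by rewrite rmorph_sign invr_sign.
Qed.

(** Otherwise [u] is an eigenvector of the involution s with eigenvalue 1 / (a_j - a_i), which must
    then be 1 or -1. *)
Lemma swapvec_neq0 : u != 0 -> a j != a i -> a j - a i != 1 -> a j - a i != -1 ->
  swapvec != 0.
Proof.
move=> u0 aij d1 dN1; apply: contra_neq u0 => v0.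
have us := swapvec_tperm; rewrite v0 addr0 -rmorphB in us; set c := _^-1 in us.
have := rSym_tpermK i j u; rewrite us -scalemxAl us scalerA -[RHS]scale1r => /eqP.
rewrite -subr_eq0 -scalerBl scaler_eq0 subr_eq0 -invfM -expr2 => /orP[|/eqP//].
rewrite invr_eq1 sqrf_eq1 -(rmorphN1 (intmul 1)) -[X in _ == X]/(1%:~R) !eqr_int.
by rewrite (negbTE d1) (negbTE dN1).
Qed.

End Adjacent.
End Weights.

(** * Standard tableaux *)

Section StandardTableaux.
Variable n : nat.
Implicit Types (la mu : seq nat) (T U : tableau n) (i j k l : 'I_n).

Definition cont T k : int := ((T k).2 : nat)%:Z - ((T k).1 : nat)%:Z.

Lemma nth_contents T k : (contents T)`_k = cont T k.
Proof.
rewrite /contents (nth_map k); last by rewrite size_enum_ord.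
by rewrite nth_ord_enum.
Qed.

Lemma StdP la T :
  reflect [/\ injective T, forall b, (b \in codom T) = (b.2 < nth 0%N la b.1)%N,
              forall k l, (T k).1 = (T l).1 -> ((T k).2 < (T l).2)%N -> (k < l)%N
            & forall k l, (T k).2 = (T l).2 -> ((T k).1 < (T l).1)%N -> (k < l)%N]
          (T \in Std n la).
Proof.
rewrite inE; apply: (iffP and4P).
  case=> /injectiveP injT /eqP/setP imT rowT colT; split=> // [b|k l e lt|k l e lt].
  - have := imT b; rewrite [in RHS]inE => <-.
    by apply/codomP/imsetP => [[k ->]|[k _ ->]]; exists k.
  - by have /forallP/(_ l) := forallP rowT k; rewrite e eqxx lt.
  - by have /forallP/(_ l) := forallP colT k; rewrite e eqxx lt.
case=> injT imT rowT colT; split.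
- exact/injectiveP.
- apply/eqP/setP => b; rewrite [in RHS]inE -imT.
  by apply/imsetP/codomP => [[k _ ->]|[k ->]]; exists k.
- by apply/forallP => k; apply/forallP => l; apply/implyP => /andP[/eqP]; apply: rowT.
- by apply/forallP => k; apply/forallP => l; apply/implyP => /andP[/eqP]; apply: colT.
Qed.

Lemma Std_inj la T : T \in Std n la -> injective T.
Proof. by case/StdP. Qed.

Lemma Std_codom la T b : T \in Std n la -> (b \in codom T) = (b.2 < nth 0%N la b.1)%N.
Proof. by case/StdP. Qed.

Lemma Std_mem la T k : T \in Std n la -> ((T k).2 < nth 0%N la (T k).1)%N.
Proof. by move=> /Std_codom <-; apply: codom_f. Qed.

(** Compare both labels with that of the box in the row of [k] and the column of [l]. *)
Lemma Std_nw la T k l : sorted geq la -> T \in Std n la ->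
  ((T k).1 <= (T l).1)%N -> ((T k).2 <= (T l).2)%N -> (k <= l)%N.
Proof.
move=> sla ST le1 le2; have [injT imT rowT colT] := StdP _ _ ST.
have : ((T k).1, (T l).2) \in codom T.
  by rewrite imT (leq_trans (Std_mem l ST)) // nth_sorted_geq.
case/codomP => m Tm; apply: (@leq_trans m).
  move: le2; rewrite leq_eqVlt => /orP[/eqP/val_inj e|lt2].
    by rewrite (injT k m) // -Tm -e -surjective_pairing.
  by apply/ltnW/rowT; rewrite -Tm.
move: le1; rewrite leq_eqVlt => /orP[/eqP/val_inj e|lt1].
  by rewrite (injT m l) // -Tm e -surjective_pairing.
by apply/ltnW/colT; rewrite -Tm.
Qed.

(** Otherwise T k lies on the same diagonal as U k, strictly to its north-west. It then carries in U
    a label l < k, and T l = U l = T k contradicts injectivity. *)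
Lemma cont_inj_step la mu T U k : sorted geq mu ->
    T \in Std n la -> U \in Std n mu ->
    (forall l, (l < k)%N -> T l = U l) -> cont T k = cont U k ->
  ((U k).1 <= (T k).1)%N.
Proof.
move=> smu ST SU eq_lt eqc; rewrite leqNgt; apply/negP => lt1.
have lt2 : ((T k).2 < (U k).2)%N by move: eqc; rewrite /cont; lia.
have : T k \in codom U.
  rewrite (Std_codom _ SU) (ltn_trans lt2) // (leq_trans (Std_mem k SU)) //.
  by rewrite nth_sorted_geq // ltnW.
case/codomP => l Tk; have le_lk : (l <= k)%N.
  by apply: (Std_nw smu SU); rewrite -Tk ltnW.
have lt_lk : (l < k)%N.
  rewrite ltn_neqAle le_lk andbT; apply/eqP => /val_inj e.
  by move: lt1; rewrite Tk e ltnn.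
have e := Std_inj ST (etrans (eq_lt l lt_lk) (esym Tk)).
by move: lt_lk; rewrite e ltnn.
Qed.

(** The shapes may differ: contents determine the shape as well, which is what separates la from its
    conjugate in [anticommuting_eq0]. *)
Lemma cont_inj la mu T U : sorted geq la -> sorted geq mu ->
  T \in Std n la -> U \in Std n mu -> cont T =1 cont U -> T = U.
Proof.
move=> sla smu ST SU eqc; apply/ffunP => k.
move: {2}k.+1 (ltnSn k) => m; elim: m k => [//|m IHm] k; rewrite ltnS => le_k.
have eq_lt l : (l < k)%N -> T l = U l by move=> lt_l; apply: IHm; apply: leq_trans le_k.
have eq1 : (T k).1 = (U k).1.
  apply/val_inj/eqP; rewrite eqn_leq (cont_inj_step sla SU ST) //; last first.
    by move=> l /eq_lt ->.
  exact: cont_inj_step smu ST SU eq_lt (eqc k).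
rewrite [LHS]surjective_pairing [RHS]surjective_pairing eq1; congr (_, _).
by apply: val_inj; move: (eqc k); rewrite /cont eq1 /=; lia.
Qed.

Lemma Std_shape_inj la mu T : sorted geq la -> sorted geq mu ->
    0%N \notin la -> 0%N \notin mu -> (size la <= n)%N -> (size mu <= n)%N ->
    (forall i : nat, nth 0%N la i <= n)%N -> (forall i : nat, nth 0%N mu i <= n)%N ->
  T \in Std n la -> T \in Std n mu -> la = mu.
Proof.
move=> sla smu la0 mu0 zla zmu nla nmu STl STm; apply: partition_nth_eq => // i j.
have [lt_i|le_i] := ltnP i n; last by rewrite !nth_default // (leq_trans _ le_i).
have [lt_j|le_j] := ltnP j n; last first.
  by rewrite !ltnNge (leq_trans (nla i) le_j) (leq_trans (nmu i) le_j).
have := Std_codom (Ordinal lt_i, Ordinal lt_j) STl.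
by rewrite (Std_codom _ STm).
Qed.

Definition swapT i j T : tableau n := [ffun k => T (tperm i j k)].

Lemma cont_swapT i j T k : cont (swapT i j T) k = cont T (tperm i j k).
Proof. by rewrite /cont ffunE. Qed.

Lemma swapTK i j : involutive (swapT i j).
Proof. by move=> T; apply/ffunP => k; rewrite !ffunE tpermK. Qed.

Section Adjacent.
Variables (la : seq nat) (i j : 'I_n) (T : tableau n).
Hypotheses (sla : sorted geq la) (adj_ij : j = i.+1 :> nat) (ST : T \in Std n la).

Lemma adj_same_row : (T i).1 = (T j).1 -> cont T j - cont T i = 1.
Proof.
move=> e; have [injT imT rowT colT] := StdP _ _ ST.
have lt2 : ((T i).2 < (T j).2)%N.
  rewrite ltnNge; apply/negP => le2.
  suff : (j <= i)%N by rewrite adj_ij ltnn.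
  by apply: (Std_nw sla ST); rewrite ?e.
suff : (T j).2 = (T i).2.+1 :> nat by rewrite /cont e; lia.
apply/eqP; rewrite eqn_leq lt2 andbT leqNgt; apply/negP => lt2'.
have lt_n : ((T i).2.+1 < n)%N by apply: ltn_trans (ltn_ord (T j).2).
have /codomP[k Tk] : ((T i).1, Ordinal lt_n) \in codom T.
  by rewrite imT /= e (ltn_trans lt2') // Std_mem.
have : (i < k)%N by apply: rowT; rewrite -Tk /=.
have : (k < j)%N by apply: rowT; rewrite -Tk /=.
by lia.
Qed.

Lemma adj_same_col : (T i).2 = (T j).2 -> cont T j - cont T i = -1.
Proof.
move=> e; have [injT imT rowT colT] := StdP _ _ ST.
have lt2 : ((T i).1 < (T j).1)%N.
  rewrite ltnNge; apply/negP => le2.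
  suff : (j <= i)%N by rewrite adj_ij ltnn.
  by apply: (Std_nw sla ST); rewrite ?e.
suff : (T j).1 = (T i).1.+1 :> nat by rewrite /cont e; lia.
apply/eqP; rewrite eqn_leq lt2 andbT leqNgt; apply/negP => lt2'.
have lt_n : ((T i).1.+1 < n)%N by apply: ltn_trans (ltn_ord (T j).1).
have /codomP[k Tk] : (Ordinal lt_n, (T i).2) \in codom T.
  rewrite imT /= e (leq_trans (Std_mem j ST)) // nth_sorted_geq //.
have : (i < k)%N by apply: colT; rewrite -Tk /=.
have : (k < j)%N by apply: colT; rewrite -Tk /=.
by lia.
Qed.

(** Two boxes of one diagonal have between them a box whose label would lie strictly between i and i
    + 1. *)
Lemma adj_cont_neq : cont T i != cont T j.
Proof.
apply/eqP => eqc; have [injT imT rowT colT] := StdP _ _ ST.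
have le_ij : (i <= j)%N by rewrite adj_ij.
have [lt1|lt1|/val_inj e] := ltngtP (T i).1 (T j).1; last first.
- by have := adj_same_row e; rewrite eqc subrr.
- have lt2 : ((T j).2 < (T i).2)%N by move: eqc; rewrite /cont; lia.
  have : (j <= i)%N by apply: (Std_nw sla ST); apply: ltnW.
  by rewrite adj_ij ltnn.
have lt2 : ((T i).2 < (T j).2)%N by move: eqc; rewrite /cont; lia.
have /codomP[k Tk] : ((T i).1, (T j).2) \in codom T.
  by rewrite imT /= (leq_trans (Std_mem j ST)) // nth_sorted_geq // ltnW.
have : (i < k)%N by apply: rowT; rewrite -Tk /=.
have : (k < j)%N by apply: colT; rewrite -Tk /=.
by lia.
Qed.

Definition generic_adj :=
  (cont T j - cont T i != 1) && (cont T j - cont T i != -1).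

(** The labels i and j share no row or column, and being consecutive they compare alike with every
    other label. *)
Lemma swapT_Std : generic_adj -> swapT i j T \in Std n la.
Proof.
case/andP => d1 dN1; have [injT imT rowT colT] := StdP _ _ ST.
have row_ij : (T i).1 <> (T j).1 by move/adj_same_row/eqP; rewrite (negbTE d1).
have col_ij : (T i).2 <> (T j).2 by move/adj_same_col/eqP; rewrite (negbTE dN1).
have ltE (k l : 'I_n) : (tperm i j k < tperm i j l)%N ->
    ~ (k = i /\ l = j \/ k = j /\ l = i) -> (k < l)%N.
  case: (tpermP i j k) => [->|->|/eqP ki /eqP kj];
    case: (tpermP i j l) => [->|->|/eqP li /eqP lj]; rewrite ?ltnn //.
  - by move=> _ []; left.
  - by move: li lj; rewrite -!(inj_eq val_inj) /=; lia.
  - by move=> _ []; right.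
  - by move: li lj; rewrite -!(inj_eq val_inj) /=; lia.
  - by move: ki kj; rewrite -!(inj_eq val_inj) /=; lia.
  - by move: ki kj; rewrite -!(inj_eq val_inj) /=; lia.
apply/StdP; split.
- by move=> k l; rewrite !ffunE => /injT/perm_inj.
- move=> b; rewrite -imT; apply/codomP/codomP => -[k ->].
    by exists (tperm i j k); rewrite ffunE.
  by exists (tperm i j k); rewrite ffunE tpermK.
- move=> k l; rewrite !ffunE => e lt; apply: ltE; first exact: rowT.
  by case=> -[ek el]; move: e; rewrite ek el tpermL tpermR => // /esym.
move=> k l; rewrite !ffunE => e lt; apply: ltE; first exact: colT.
by case=> -[ek el]; move: e; rewrite ek el tpermL tpermR => // /esym.
Qed.

End Adjacent.

Definition trT T : tableau n := [ffun k => ((T k).2, (T k).1)].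

Lemma cont_trT T k : cont (trT T) k = - cont T k.
Proof. by rewrite /cont ffunE opprB. Qed.

Lemma trTK : involutive trT.
Proof. by move=> T; apply/ffunP => k; rewrite !ffunE /= -surjective_pairing. Qed.

Lemma trT_Std la T : sorted geq la -> T \in Std n la ->
  trT T \in Std n (conj_partition la).
Proof.
move=> sla /StdP[injT imT rowT colT]; apply/StdP; split.
- move=> k l; rewrite !ffunE => -[e2 e1]; apply: injT.
  by rewrite [LHS]surjective_pairing [RHS]surjective_pairing e1 e2.
- move=> b; rewrite nth_conj // -[LHS]/(b \in codom (trT T)).
  rewrite -(imT (b.2, b.1)); apply/codomP/codomP => -[k e]; exists k.
    by rewrite e ffunE -surjective_pairing.
  by rewrite ffunE -e -surjective_pairing.
- by move=> k l; rewrite !ffunE; apply: colT.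
by move=> k l; rewrite !ffunE; apply: rowT.
Qed.

End StandardTableaux.

(** * Reaching every standard tableau from the row reading by admissible swaps *)

Section RowReadingTableau.
Variables (n : nat) (la : seq nat).
Hypothesis la_part : is_partition n la.
Local Notation rrow := (rrow la_part).
Local Notation rcol := (@rcol n la).
Implicit Types T : tableau n.

Lemma part_size : (size la <= n)%N.
Proof.
rewrite -(sumn_part la_part); move: (part_neq0 la_part); elim: la => //= x l IHl.
by rewrite inE negb_or eq_sym -lt0n => /andP[x0 /IHl]; lia.
Qed.

Lemma part_nth_le i : (nth 0%N la i <= n)%N.
Proof.
rewrite -(sumn_part la_part); elim: la i => [|x l IHl] [|i] //=; first exact: leq_addr.
exact: leq_trans (IHl i) (leq_addl _ _).
Qed.

Lemma nonconj_gt1 : la <> conj_partition la -> (1 < n)%N.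
Proof.
move=> la_nonconj; rewrite ltnNge; apply/negP => le_n1; apply: la_nonconj.
have := part_size; have := part_nth_le 0; have := (part_neq0 la_part).
case: la => [|[|[|x]] [|y l]] //=; rewrite ?inE //; lia.
Qed.

Lemma Std_conj_disjoint T : la <> conj_partition la ->
  T \in Std n la -> T \notin Std n (conj_partition la).
Proof.
move=> la_nonconj ST; apply/negP => ST'; apply: la_nonconj.
have sla := part_sorted la_part; have la0 := part_neq0 la_part.
apply: (Std_shape_inj sla (sorted_conj sla) la0 (conj_neq0 sla) part_size) ST ST' => //.
- by rewrite size_mkseq -nth0 part_nth_le.
- exact: part_nth_le.
by move=> k; rewrite leqNgt nth_conj // nth_default // part_size.
Qed.

(** The default of [insubd] is never taken, by [part_size] and [part_nth_le]. *)
Definition rtableau : tableau n := [ffun k => (insubd k (rrow k : nat), insubd k (rcol k))].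

Lemma rtableau_row k : (rtableau k).1 = rrow k :> nat.
Proof.
by rewrite ffunE val_insubd (leq_trans (ltn_ord (rrow k)) part_size).
Qed.

Lemma rtableau_col k : (rtableau k).2 = rcol k :> nat.
Proof.
by rewrite ffunE val_insubd (leq_trans (rcol_lt la_part k) (part_nth_le _)).
Qed.

Lemma rtableau_inj : injective rtableau.
Proof.
move=> k l e; apply: (@rcell_inj _ _ la_part); last by rewrite -!rtableau_col e.
by apply: val_inj; rewrite /= -!rtableau_row e.
Qed.

Lemma rtableau_ltn (k l : 'I_n) : (k < l)%N =
  ((rtableau k).1 < (rtableau l).1)%N ||
  ((rtableau k).1 == (rtableau l).1) && ((rtableau k).2 < (rtableau l).2)%N.
Proof.
by rewrite (rrow_ltn la_part) -!(inj_eq val_inj) /= -!rtableau_row -!rtableau_col.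
Qed.

Lemma rtableau_Std : rtableau \in Std n la.
Proof.
apply/StdP; split; first exact: rtableau_inj.
- move=> [r c]; apply/codomP/idP => [[k ->]|/= lt_c].
    by rewrite rtableau_row rtableau_col rcol_lt.
  have lt_r : (r < size la)%N.
    by rewrite ltnNge; apply/negP => le_r; rewrite nth_default in lt_c.
  have [rk ck] := rcellP la_part (r := Ordinal lt_r) lt_c.
  exists (rcell la_part (r := Ordinal lt_r) lt_c).
  rewrite [RHS]surjective_pairing; congr (_, _); apply: val_inj => /=.
    by rewrite rtableau_row rk.
  by rewrite rtableau_col ck.
- by move=> k l e lt; rewrite rtableau_ltn e ltnn eqxx.
by move=> k l _ lt; rewrite rtableau_ltn lt.
Qed.

Lemma cont_rtableau k : cont rtableau k = (rcol k)%:Z - (rrow k : nat)%:Z.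
Proof. by rewrite /cont rtableau_row rtableau_col. Qed.

(* The position of the box labelled k in the row reading order, for standard T. *)
Definition rpos T k : 'I_n := odflt k [pick m | rtableau m == T k].

Lemma rposK T k : T \in Std n la -> rtableau (rpos T k) = T k.
Proof.
move=> ST; rewrite /rpos; case: pickP => [m /eqP //|no_m].
have : T k \in codom rtableau by rewrite (Std_codom _ rtableau_Std) (Std_mem k ST).
by case/codomP => m e; move: (no_m m); rewrite e eqxx.
Qed.

Lemma rpos_swap i j T k : T \in Std n la -> swapT i j T \in Std n la ->
  rpos (swapT i j T) k = rpos T (tperm i j k).
Proof. by move=> ST ST'; apply: rtableau_inj; rewrite !rposK // ffunE. Qed.

Lemma rpos_descent (i j : 'I_n) T : j = i.+1 :> nat -> T \in Std n la ->
  (rpos T j < rpos T i)%N -> generic_adj i j T.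
Proof.
move=> adj ST; rewrite rtableau_ltn !rposK // => lt_pos.
have [_ _ rowT _] := StdP _ _ ST.
have {lt_pos} lt1 : ((T j).1 < (T i).1)%N.
  case/orP: lt_pos => // /andP[/eqP e] /(rowT _ _ e); rewrite adj; lia.
have lt2 : ((T i).2 < (T j).2)%N.
  rewrite ltnNge; apply/negP => le2.
  have : (j <= i)%N by apply: (Std_nw (part_sorted la_part) ST) => //; apply: ltnW.
  by rewrite adj ltnn.
by rewrite /generic_adj /cont; lia.
Qed.

(** A strictly increasing map of 'I_n to itself is the identity. *)
Lemma rpos_ascending T : T \in Std n la ->
  (forall i j : 'I_n, j = i.+1 :> nat -> (rpos T i < rpos T j)%N) -> T = rtableau.
Proof.
move=> ST asc.
have grow m (i j : 'I_n) : (j = i + m :> nat -> rpos T i + m <= rpos T j)%N.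
  elim: m j => [|m IHm] j ej; first by move: ej; rewrite !addn0 => /val_inj ->.
  have lt_n : (i + m < n)%N by rewrite (leq_trans _ (ltn_ord j)) // ej addnS.
  have /= := IHm (Ordinal lt_n) erefl; rewrite addnS => le_m.
  by apply: leq_ltn_trans le_m _; apply: asc; rewrite ej addnS.
apply/ffunP => k; rewrite -rposK //; congr (rtableau _); apply/val_inj/eqP => /=.
have n0 : (0 < n)%N by apply: leq_trans (ltn_ord k).
have n1 : (n.-1 < n)%N by rewrite prednK.
rewrite eqn_leq; apply/andP; split; last first.
  by apply: leq_trans (grow k (Ordinal n0) k erefl); apply: leq_addl.
have /= := grow (n.-1 - k)%N k (Ordinal n1).
have := ltn_ord (rpos T (Ordinal n1)); have := ltn_ord k; lia.
Qed.

(** If i + 1 is read before i, swapping them is admissible by [rpos_descent] and increases the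
    bounded sum [Phi]. Without such i the tableau is the row reading. *)
Lemma Std_swap_ind (Pr : tableau n -> Prop) :
    Pr rtableau ->
    (forall T (i j : 'I_n), j = i.+1 :> nat -> T \in Std n la -> swapT i j T \in Std n la ->
       generic_adj i j T -> Pr T -> Pr (swapT i j T)) ->
  forall T, T \in Std n la -> Pr T.
Proof.
move=> Pr0 PrS T; pose Phi (T : tableau n) := (\sum_(k < n) k * rpos T k)%N.
have le_Phi U : (Phi U <= n * (n * n))%N.
  rewrite -[X in (_ <= X * _)%N]card_ord -sum_nat_const; apply: leq_sum => k _.
  by rewrite leq_mul // ltnW.
move: {2}(n * (n * n) - Phi T)%N (leqnn (n * (n * n) - Phi T)%N) => m.
elim: m T => [|m IHm] T le_m ST.
all: have [no_desc|] := boolP [forall i : 'I_n, forall j : 'I_n,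
    (j == i.+1 :> nat) ==> (rpos T i < rpos T j)%N].
1,3: rewrite (rpos_ascending ST) // => i j /eqP adj;
  by move/forallP/(_ i)/forallP/(_ j): no_desc; rewrite adj.
all: case/forallPn => i /forallPn [j]; rewrite negb_imply -leqNgt => /andP[/eqP adj].
all: have ij : i != j by apply/eqP => e; move: adj; rewrite e; lia.
all: rewrite leq_eqVlt => /orP[/eqP/val_inj e|lt_pos];
  first by case/eqP: ij; apply: (Std_inj ST); rewrite -[LHS]rposK // -e rposK.
all: have gen := rpos_descent adj ST lt_pos.
all: have ST' := swapT_Std (part_sorted la_part) adj ST gen.
all: have lt_Phi : (Phi T < Phi (swapT i j T))%N.
1,3: rewrite /Phi (bigD1 i) // (bigD1 j) 1?eq_sym //=;
  rewrite [ltnRHS](bigD1 i) // [X in (_ < _ + X)%N](bigD1 j) 1?eq_sym //=;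
  rewrite !rpos_swap // tpermL tpermR addnA [ltnRHS]addnA;
  rewrite (eq_bigr (fun k : 'I_n => k * rpos (swapT i j T) k)%N);
  first (by rewrite ltn_add2r adj; nia);
  by move=> k /andP[ki kj]; rewrite rpos_swap // tpermD // eq_sym.
  by have := le_Phi (swapT i j T); lia.
(* Swaps are involutions, so T is reached back from the swapped tableau, whose [Phi] is larger. *)
rewrite -[T](swapTK i j); apply: PrS => //; first by rewrite swapTK.
- move: gen; rewrite /generic_adj !cont_swapT tpermL tpermR -!(opprB (cont T j)).
  by rewrite !eqr_oppLR opprK andbC.
by apply: IHm => //; have := le_Phi (swapT i j T); lia.
Qed.

End RowReadingTableau.

(** * Seminormal bases *)

(** When the colour classes are intervals, (i, j) is the conjugate of (i, j-1) by (j-1, j) inside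
    the class. Applied to rows and, with a constant colouring, to all of S_n. *)
Lemma stabf_adj_ind n (I : eqType) (f : 'I_n -> I) (Pr : {perm 'I_n} -> Prop) :
    (forall i j k : 'I_n, (i <= j <= k)%N -> f i = f k -> f i = f j) ->
    Pr 1%g ->
    (forall g (i j : 'I_n), j = i.+1 :> nat -> f i = f j -> Pr g -> Pr (g * tperm i j)%g) ->
  forall s, s \in stabf f -> Pr s.
Proof.
move=> convf Pr1 PrS.
suff PrT m (i j : 'I_n) g : j = (i + m)%N :> nat -> f i = f j -> Pr g -> Pr (g * tperm i j)%g.
  apply: stabf_ind => // s i j _ fij Ps.
  have [le_ij|/ltnW le_ji] := leqP i j; first by apply: (PrT (j - i)%N); rewrite ?subnKC.
  by rewrite tpermC; apply: (PrT (i - j)%N); rewrite ?subnKC.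
elim: m j g => [|m IHm] j g ej fij Pg.
  by rewrite addn0 in ej; rewrite (val_inj ej) tperm1 mulg1.
have lt_k : (i + m < n)%N by rewrite (leq_trans _ (ltn_ord j)) // ej addnS.
pose k := Ordinal lt_k; have ejk : j = k.+1 :> nat by rewrite ej addnS.
have fik : f i = f k by apply: (convf i k j); rewrite // ejk leq_addr leqnSn.
have [eik|ik] := eqVneq i k; first by apply: PrS; rewrite // eik.
have ij : i != j by apply/eqP => e; move: ej; rewrite e; lia.
have kj : k != j by apply/eqP => e; move: ejk; rewrite e; lia.
have -> : tperm i j = (tperm k j * tperm i k * tperm k j)%g.
  have -> : tperm i j = (tperm i k ^ tperm k j)%g.
    by rewrite tpermJ tpermL tpermD // eq_sym.
  by rewrite conjgE tpermV !mulgA.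
rewrite !mulgA; apply: (PrS); rewrite -?fik //; apply: IHm => //.
by apply: PrS; rewrite -?fik.
Qed.

Lemma rank_diag_mx (F : fieldType) m (D : 'rV[F]_m) :
  \rank (diag_mx D) = #|[set i | D 0 i != 0]|.
Proof.
pose A := [set i | D 0 i != 0]; pose S : 'M[F]_(#|A|, m) := rowsub enum_val 1%:M.
have row_S k : row k S = delta_mx 0 (enum_val k) by rewrite row_rowsub row1.
have -> : \rank (diag_mx D) = \rank S.
  apply/eqP; rewrite eqn_leq; apply/andP; split; apply: mxrankS; apply/row_subP => i.
    rewrite row_diag_mx; have [->|Di] := eqVneq (D 0 i) 0; first by rewrite scale0r sub0mx.
    have Ai : i \in A by rewrite inE.
    by rewrite scalemx_sub // -(enum_rankK_in Ai Ai) -row_S row_sub.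
  have := enum_valP i; rewrite inE => Di.
  rewrite row_S -[delta_mx _ _]scale1r -(mulVf Di) -scalerA -row_diag_mx.
  by rewrite scalemx_sub // row_sub.
apply/eqP/row_freeP; exists S^T; apply/matrixP => i j.
rewrite mxE (bigD1 (enum_val i)) //= big1 ?addr0 => [|k ki]; rewrite !mxE.
  by rewrite eqxx mul1r (inj_eq enum_val_inj) eq_sym.
by rewrite eq_sym (negbTE ki) mul0r.
Qed.

Lemma rank_eigenspace_basis (F : fieldType) d (T : finType) (S : {set T})
    (M : 'M[F]_d) (x : T -> 'rV[F]_d) (e : T -> F) (mu : F) :
    #|S| = d -> row_full (\sum_(t in S) <<x t>>)%MS ->
    {in S, forall t, x t *m M = e t *: x t} ->
  \rank (eigenspace M mu) = #|[set t in S | e t == mu]|.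
Proof.
move=> cardS fullS eigx.
pose B : 'M[F]_(#|S|, d) := \matrix_i x (enum_val i).
pose D : 'rV[F]_#|S| := \row_i (e (enum_val i) - mu).
have fullB : row_full B.
  rewrite -sub1mx (submx_trans (_ : _ <= \sum_(t in S) <<x t>>)%MS) ?sub1mx //.
  apply/sumsmx_subP => t St; rewrite genmxE -(enum_rankK_in St St).
  by rewrite -[x _](rowK (fun i => x (enum_val i))) row_sub.
have freeB : row_free B by rewrite -row_leq_rank (eqP fullB) cardS.
have eqBD : B *m (M - mu%:M) = diag_mx D *m B.
  apply/row_matrixP => i; rewrite !row_mul rowK.
  rewrite row_diag_mx -scalemxAl -rowE rowK mxE mulmxBr eigx ?enum_valP // mul_mx_scalar.
  by rewrite scalerBl.
have rkD : \rank (M - mu%:M) = #|[set i | D 0 i != 0]|.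
  by rewrite -(eqmxMfull _ fullB) eqBD mxrankMfree // rank_diag_mx.
have -> : \rank (eigenspace M mu) = #|~: [set i | D 0 i != 0]|.
  rewrite mxrank_ker rkD [RHS]cardsCs setCK; congr (_ - _)%N.
  by rewrite card_ord cardS.
rewrite -(card_imset _ (@enum_val_inj _ (mem S))); apply: eq_card => t.
rewrite inE; apply/imsetP/andP => [[i Di ->]|[St /eqP et]].
  move: Di; rewrite !inE negbK mxE subr_eq0 => ->; split=> //; exact: enum_valP.
exists (enum_rank_in St t); rewrite ?enum_rankK_in // !inE mxE enum_rankK_in //.
by rewrite et subrr eqxx.
Qed.

Section SeminormalBasis.
Local Open Scope group_scope.
Local Open Scope ring_scope.
Variables (F : numClosedFieldType) (n : nat) (la : seq nat) (d : nat).
Hypothesis la_part : is_partition n la.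
Variable rG : mx_representation F 'Sym_('I_n) d.
Implicit Types (T U : tableau n) (u v : 'rV[F]_d) (i j : 'I_n).
Local Notation wt T := (weight rG (cont T)).

Lemma weight_ext (a b : 'I_n -> int) u : a =1 b -> weight rG a u -> weight rG b u.
Proof. by move=> eq_ab ua k; rewrite ua eq_ab. Qed.

Lemma weight_swapT T i j u : j = i.+1 :> nat -> T \in Std n la -> wt T u ->
  wt (swapT i j T) (swapvec rG i j (cont T) u).
Proof.
move=> adj ST uT; apply: weight_ext (weight_swap adj uT _).
  by move=> k; rewrite cont_swapT.
exact: adj_cont_neq (part_sorted la_part) adj ST.
Qed.

Lemma swapvec_swapT T i j u :
  swapvec rG i j (cont T) (swapvec rG i j (cont (swapT i j T)) u) =
  (1 - ((cont T j)%:~R - (cont T i)%:~R)^-2) *: u.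
Proof.
rewrite /swapvec !cont_swapT tpermL tpermR.
rewrite -[(_ - (cont T j)%:~R)]opprB invrN scaleNr opprK.
set c := (_ - _)^-1; rewrite mulmxDl rSym_tpermK -scalemxAl scalerDr scalerA.
by rewrite opprD addrA addrK scalerBl scale1r -exprVn expr2.
Qed.

Lemma generic_inv_sqr T i j : generic_adj i j T ->
  1 - ((cont T j)%:~R - (cont T i)%:~R)^-2 != 0 :> F.
Proof.
case/andP => d1 dN1; rewrite subr_eq0 eq_sym invr_eq1 sqrf_eq1 -rmorphB.
by rewrite -[X in _ == - X]/(1%:~R) -rmorphN -[X in _ == X]/(1%:~R) !eqr_int negb_or d1.
Qed.

Lemma swapvecZ T i j c u :
  swapvec rG i j (cont T) (c *: u) = c *: swapvec rG i j (cont T) u.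
Proof. by rewrite /swapvec -scalemxAl scalerBr !scalerA mulrC. Qed.

Variable v0 : 'rV[F]_d.
Hypotheses (v0_neq0 : v0 != 0) (v0_wt : wt (rtableau la_part) v0).
Hypothesis v0_uniq : forall u, wt (rtableau la_part) u -> exists c, u = c *: v0.

(** Along an admissible swap [swapvec] maps one weight space to the other. Swapping back multiplies
    by 1 - (a_j - a_i)^-2, which is nonzero, so the new space is again a line. *)
Lemma weight_vectors : exists v : tableau n -> 'rV[F]_d,
  forall T, T \in Std n la ->
    [/\ v T != 0, wt T (v T) & forall u, wt T u -> exists c, u = c *: v T].
Proof.
pose Pr T := exists2 v, v != 0 & wt T v /\ forall u, wt T u -> exists c, u = c *: v.
suff PrT T : exists v, T \in Std n la ->
    [/\ v != 0, wt T v & forall u, wt T u -> exists c, u = c *: v].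
  exact: fin_all_exists PrT.
have [ST|_] := boolP (T \in Std n la); last by exists 0.
suff [v vn0 [vT uniq]] : Pr T by exists v.
move: T ST; apply: (@Std_swap_ind n la la_part Pr); first by exists v0.
move=> T i j adj ST ST' gen [v vn0 [vT uniq]].
have cij := adj_cont_neq (part_sorted la_part) adj ST.
have [d1 dN1] := andP gen.
exists (swapvec rG i j (cont T) v).
  by apply: swapvec_neq0 => //; rewrite eq_sym.
split=> [|u uT']; first exact: weight_swapT.
have u'T := weight_swapT adj ST' uT'; rewrite swapTK in u'T.
have [c Hc] := uniq _ u'T; exists ((1 - ((cont T j)%:~R - (cont T i)%:~R)^-2)^-1 * c).
rewrite -scalerA -swapvecZ -Hc swapvec_swapT scalerA mulVf ?scale1r //.
exact: generic_inv_sqr.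
Qed.

Hypothesis v0_gen : forall U : 'M[F]_d, mxmodule rG U -> (v0 <= U)%MS -> row_full U.
Variable v : tableau n -> 'rV[F]_d.
Hypothesis v_neq0 : forall T, T \in Std n la -> v T != 0.
Hypothesis v_wt : forall T, T \in Std n la -> wt T (v T).
Hypothesis v_uniq : forall T, T \in Std n la -> forall u, wt T u -> exists c, u = c *: v T.

Let sla := part_sorted la_part.

Lemma Std_cont_neq T U : T \in Std n la -> U \in Std n la -> T != U ->
  exists k, cont T k != cont U k.
Proof.
move=> ST SU TU; apply/existsP; apply: contraNT TU; rewrite negb_exists => /forallP no.
apply/eqP/(cont_inj sla sla ST SU) => k.
by apply/eqP; move: (no k); rewrite negbK.
Qed.

Lemma v_orthogonal T U : T \in Std n la -> U \in Std n la -> T != U ->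
  hform rG (v T) (v U) = 0.
Proof.
move=> ST SU /(Std_cont_neq ST SU)[k nk].
exact: weight_orthogonal (v_wt ST) (v_wt SU) nk.
Qed.

Lemma v_tperm T i j : j = i.+1 :> nat -> T \in Std n la ->
  v T *m rG (tperm i j) =
  ((cont T j)%:~R - (cont T i)%:~R)^-1 *: v T + swapvec rG i j (cont T) (v T).
Proof. by move=> adj ST; apply: swapvec_tperm. Qed.

Lemma v_tperm_generic T i j : j = i.+1 :> nat -> T \in Std n la -> generic_adj i j T ->
  exists2 c, c != 0 & swapvec rG i j (cont T) (v T) = c *: v (swapT i j T).
Proof.
move=> adj ST gen; have ST' := swapT_Std sla adj ST gen.
have [c Hc] := v_uniq ST' (weight_swapT adj ST (v_wt ST)); exists c => //.
have [d1 dN1] := andP gen.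
have cij := adj_cont_neq sla adj ST.
have : swapvec rG i j (cont T) (v T) != 0.
  by apply: swapvec_neq0 (v_neq0 ST) _ d1 dN1; rewrite eq_sym.
by apply: contra_neq => c0; rewrite Hc c0 scale0r.
Qed.

Lemma v_tperm_nongeneric T i j : j = i.+1 :> nat -> T \in Std n la ->
  ~~ generic_adj i j T ->
  v T *m rG (tperm i j) = (-1) ^+ (cont T j < cont T i)%R *: v T.
Proof.
move=> adj ST; rewrite negb_and !negbK => d1; apply: (weight_adj_sign adj (v_wt ST)).
case/orP: d1 => /eqP dij; rewrite dij.
  by rewrite [_ < _](_ : _ = false) //; lia.
by rewrite [_ < _](_ : _ = true) //; lia.
Qed.

(** Adjacent transpositions keep v T in the span of v T and v (s T), so the span is a submodule; it
    contains the generator [v0]. *)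
Lemma v_span : row_full (\sum_(T in Std n la) <<v T>>)%MS.
Proof.
set S := (\sum_(T in _) _)%MS.
have vS T : T \in Std n la -> (v T <= S)%MS.
  by move=> ST; rewrite (sumsmx_sup T) ?genmxE.
apply: v0_gen; last first.
  have [c ->] := v_uniq (rtableau_Std la_part) v0_wt.
  by rewrite scalemx_sub // vS // rtableau_Std.
apply/mxmoduleP => g _.
have: g \in stabf (fun _ : 'I_n => tt) by apply/stabfP.
apply: (stabf_adj_ind (Pr := fun g => (S *m rG g <= S)%MS)) => //.
  by rewrite repr_mx1 mulmx1.
move=> {}g i j adj _ Sg; rewrite rSymM mulmxA (submx_trans (submxMr _ Sg)) //.
rewrite {1}/S sumsmxMr; apply/sumsmx_subP => T ST; rewrite (eqmxMr _ (genmxE _)).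
have [gen|ngen] := boolP (generic_adj i j T); last first.
  by rewrite v_tperm_nongeneric // scalemx_sub // vS.
rewrite v_tperm // addmx_sub ?scalemx_sub ?vS //.
by have [c _ ->] := v_tperm_generic adj ST gen; rewrite scalemx_sub // vS // swapT_Std.
Qed.

Lemma v_expand u : exists c : tableau n -> F, u = \sum_(T in Std n la) c T *: v T.
Proof.
have /sub_sumsmxP[w ->] := submx_full u v_span.
have wT T : exists c, w T *m <<v T>>%MS = c *: v T.
  apply/sub_rVP; apply: submx_trans (submxMl _ _) _; by rewrite genmxE.
have [c Hc] := fin_all_exists wT; exists c; exact: eq_bigr.
Qed.

Lemma hform_v_expand (c : tableau n -> F) U : U \in Std n la ->
  hform rG (\sum_(T in Std n la) c T *: v T) (v U) = c U * hform rG (v U) (v U).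
Proof.
move=> SU; rewrite hform_suml (bigD1 U) //= big1 ?addr0 ?hformZl // => T /andP[ST TU].
by rewrite hformZl v_orthogonal ?mulr0.
Qed.

(** Some v T has a nonzero coefficient in [u], hence is not orthogonal to it, and the two weights
    agree. *)
Lemma weight_Std b u : u != 0 -> weight rG b u ->
  exists2 T, T \in Std n la & cont T =1 b.
Proof.
move=> u0 ub; have [c eu] := v_expand u.
have [/existsP[T /andP[ST cT]]|] := boolP [exists T, (T \in Std n la) && (c T != 0)].
  exists T => // k; apply/eqP; rewrite eq_sym; apply: contraNT cT => nk.
  have := weight_orthogonal ub (v_wt ST) nk.
  rewrite eu hform_v_expand // => /eqP; rewrite mulf_eq0 hform_eq0.
  by rewrite (negbTE (v_neq0 ST)) orbF.
rewrite negb_exists => /forallP no; case/eqP: u0; rewrite eu big1 // => T ST.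
by move: (no T); rewrite ST negbK => /eqP ->; rewrite scale0r.
Qed.

Lemma card_Std : #|Std n la| = d.
Proof.
pose B : 'M[F]_(#|Std n la|, d) := \matrix_i v (enum_val i).
apply/eqP; rewrite eqn_leq; apply/andP; split; last first.
  have /eqP <- : row_full B; last exact: rank_leq_row.
  rewrite -sub1mx (submx_trans (_ : _ <= \sum_(T in Std n la) <<v T>>)%MS) //.
    by rewrite sub1mx v_span.
  apply/sumsmx_subP => T ST; rewrite genmxE -(enum_rankK_in ST ST).
  by rewrite -[v _](rowK (fun m : 'I_#|Std n la| => v (enum_val m))) row_sub.
suff /eqP <- : row_free B by apply: rank_leq_col.
rewrite -kermx_eq0; apply/eqP.
apply/row_matrixP => i; rewrite row0.
have: row i (kermx B) *m B = 0 by rewrite -row_mul mulmx_ker row0.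
move: (row i _) => w; rewrite mulmx_sum_row => w0; apply/rowP => k; rewrite mxE.
have := congr1 (hform rG ^~ (v (enum_val k))) w0; rewrite hform0l hform_suml.
rewrite (bigD1 k) //= big1 => [|m mk]; rewrite hformZl rowK.
  move/eqP; rewrite addr0 mulf_eq0 hform_eq0 (negbTE (v_neq0 (enum_valP k))) orbF.
  by move/eqP.
by rewrite v_orthogonal ?enum_valP ?mulr0 // (inj_eq enum_val_inj).
Qed.

Section Spectrum.
Variables (i j : 'I_n).
Hypothesis adj : j = i.+1 :> nat.
Local Notation s := (tperm i j).
(** The eigenvalue of s on v T when i and j are adjacent in T; otherwise T and its swap get opposite
    signs, so each pair yields both eigenvalues of s. *)
Local Notation eps T := ((-1) ^+ (cont T j < cont T i)%R : F).

Lemma jm_sum_comm : rG s *m (jm rG i + jm rG j) = (jm rG i + jm rG j) *m rG s.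
Proof.
rewrite mulmxDr mulmxDl (jm_tperm_adj rG adj) (jm_adj_tperm rG adj).
by rewrite addrCA addrA addrC addrA.
Qed.

(* If i and j are adjacent in T, then v T s = eps v T and this is 2 eps v T.  *)
Definition eigvec T : 'rV[F]_d := v T *m rG s + eps T *: v T.
Definition eigval T : F := eps T * (cont T i + cont T j)%:~R.

Lemma eigvecP T : T \in Std n la ->
  eigvec T *m (rG s *m (jm rG i + jm rG j)) = eigval T *: eigvec T.
Proof.
move=> ST; have vZ : v T *m (jm rG i + jm rG j) = (cont T i + cont T j)%:~R *: v T.
  by rewrite mulmxDr !(v_wt ST) -scalerDl intrD.
have xs : eigvec T *m rG s = eps T *: eigvec T.
  rewrite /eigvec mulmxDl rSym_tpermK -scalemxAl scalerDr scalerA -expr2 sqrr_sign.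
  by rewrite scale1r addrC.
have xZ : eigvec T *m (jm rG i + jm rG j) = (cont T i + cont T j)%:~R *: eigvec T.
  rewrite /eigvec mulmxDl -mulmxA jm_sum_comm mulmxA vZ -!scalemxAl vZ.
  by rewrite scalerDr !scalerA mulrC.
by rewrite mulmxA xs -scalemxAl xZ scalerA.
Qed.

Lemma eigvec_span : row_full (\sum_(T in Std n la) <<eigvec T>>)%MS.
Proof.
set X := (\sum_(T in _) _)%MS.
have xX T : T \in Std n la -> (eigvec T <= X)%MS.
  by move=> ST; rewrite (sumsmx_sup T) ?genmxE.
rewrite -sub1mx (submx_trans (_ : _ <= \sum_(T in Std n la) <<v T>>)%MS) //.
  by rewrite sub1mx v_span.
apply/sumsmx_subP => T ST; rewrite genmxE.
have two : 2%:R != 0 :> F by rewrite pnatr_eq0.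
suff vX : (2%:R *: v T <= X)%MS.
  by rewrite -[v T]scale1r -(mulVf two) -scalerA scalemx_sub.
have [gen|ngen] := boolP (generic_adj i j T); last first.
  have <- : eps T *: eigvec T = 2%:R *: v T.
    rewrite /eigvec (v_tperm_nongeneric adj ST ngen) -scalerDl -mulr2n scalerA.
    by rewrite mulrnAr -expr2 sqrr_sign.
  by rewrite scalemx_sub // xX.
have ST' := swapT_Std sla adj ST gen.
have [c _ Hc] := v_tperm_generic adj ST gen.
set g : F := ((cont T j)%:~R - (cont T i)%:~R)^-1.
have cij := adj_cont_neq sla adj ST.
have eps' : eps (swapT i j T) = - eps T.
  rewrite !cont_swapT tpermL tpermR; case: (ltgtP (cont T i) (cont T j)) cij => //= _ _.
  by rewrite expr1 opprK.
have g1 : 1 + eps T * g != 0.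
  apply: contraNneq (generic_inv_sqr gen) => e0.
  have -> : 1 - ((cont T j)%:~R - (cont T i)%:~R)^-2 = (1 + eps T * g) * (1 - eps T * g).
    by rewrite [RHS]mulrC -subr_sqr expr1n exprMn sqrr_sign mul1r -exprVn.
  by rewrite e0 mul0r.
(* The partner's eigenvector is proportional to v T - eps v T s; adding eps times [eigvec T] leaves
   2 v T. *)
have cx : c *: eigvec (swapT i j T) = (1 + eps T * g) *: (v T - eps T *: (v T *m rG s)).
  rewrite /eigvec eps' scaleNr scalerBr (scalemxAl c) -Hc scalerA [c * _]mulrC -scalerA -Hc.
  rewrite /swapvec -/g mulmxBl rSym_tpermK -scalemxAl !scalerBr !scalerA opprB.
  rewrite scalerDl scale1r mulrDl mul1r mulrAC -expr2 sqrr_sign mul1r scalerDl opprD.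
  by rewrite addrACA; congr (_ + _); rewrite addrC.
have <- : eps T *: eigvec T + (1 + eps T * g)^-1 *: (c *: eigvec (swapT i j T)) = 2%:R *: v T.
  rewrite cx scalerA mulVf // scale1r /eigvec scalerDr scalerA -expr2 sqrr_sign scale1r.
  by rewrite addrC addrA subrK -mulr2n -scaler_nat.
by rewrite addmx_sub ?scalemx_sub ?xX.
Qed.

Lemma rank_eigenspace_jm mu :
  \rank (eigenspace (rG s *m (jm rG i + jm rG j)) mu) =
  #|[set T in Std n la | eigval T == mu]|.
Proof. exact: rank_eigenspace_basis card_Std eigvec_span eigvecP. Qed.

End Spectrum.

Hypothesis la_nonconj : la <> conj_partition la.

(* An element of the commutant of Alt splits into a part commuting and a part *)
(* anticommuting with the odd permutations; the latter negates weights, and   *)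
(* the negated contents are those of tableaux of the conjugate shape.         *)
Lemma anticommuting_eq0 (M : 'M[F]_d) :
    (forall g, odd_perm g -> rG g *m M = - (M *m rG g)) -> M = 0.
Proof.
move=> anti.
have antiJ k : jm rG k *m M = - (M *m jm rG k).
  rewrite /jm mulmx_suml mulmx_sumr -sumrN; apply: eq_bigr => i lt_i.
  by rewrite anti // odd_tperm; apply/eqP => e; rewrite e ltnn in lt_i.
have vM T : T \in Std n la -> v T *m M = 0.
  move=> ST; have [//|vM0] := eqVneq (v T *m M) 0.
  have wM : weight rG (cont (trT T)) (v T *m M).
    move=> k; rewrite -[in LHS]mulmxA -[M *m _]opprK -antiJ mulmxN mulmxA v_wt //.
    by rewrite -scalemxAl cont_trT rmorphN scaleNr.
  have [U SU eUT] := weight_Std vM0 wM.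
  have ST' := trT_Std sla ST; have eU := cont_inj sla (sorted_conj sla) SU ST' eUT.
  by have := Std_conj_disjoint la_part la_nonconj SU; rewrite eU ST'.
apply/row_matrixP => k; rewrite row0 -[M]mul1mx row_mul.
have [c ->] := v_expand (row k 1%:M); rewrite mulmx_suml big1 // => T ST.
by rewrite -scalemxAl vM // scaler0.
Qed.

(** Once M commutes with all of S_n it preserves the weight line of [v0]. The eigenspace of M
    through [v0] is then a submodule containing a generator. *)
Lemma alt_commutant_scalar (M : 'M[F]_d) : (1 < n)%N ->
  (forall g, ~~ odd_perm g -> rG g *m M = M *m rG g) -> exists a, M = a%:M.
Proof.
move=> n1 comM; pose i : 'I_n := Ordinal (ltnW n1); pose j := Ordinal n1.
pose s := tperm i j; have odd_s : odd_perm s by rewrite odd_tperm.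
(* This difference anticommutes with every odd g, because g s and s g are even and commute with
   M. *)
have M2_0 : M - rG s *m M *m rG s = 0.
  apply: anticommuting_eq0 => g odd_g.
  have e1 : rG g *m (rG s *m M *m rG s) = M *m rG g.
    rewrite !mulmxA -rSymM comM ?odd_permM ?odd_g ?odd_s // -mulmxA -rSymM.
    by rewrite -mulgA tperm2 mulg1.
  have e2 : rG s *m M *m rG s *m rG g = rG g *m M.
    rewrite -mulmxA -rSymM -mulmxA -comM ?odd_permM ?odd_g ?odd_s // mulmxA -rSymM.
    by rewrite mulgA tperm2 mul1g.
  by rewrite mulmxBr mulmxBl e1 e2 opprB.
have comS g : rG g *m M = M *m rG g.
  have [odd_g|/comM //] := boolP (odd_perm g).
  have Ms : M *m rG s = rG s *m M.
    by move/eqP: M2_0; rewrite subr_eq0 => /eqP eM; rewrite [in LHS]eM rSym_tpermK.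
  rewrite -[g](mulgKV s) rSymM -mulmxA -Ms mulmxA comM ?odd_permM ?odd_permV ?odd_g ?odd_s //.
  by rewrite -mulmxA.
have [a va] : exists a, v0 *m M = a *: v0.
  apply: v0_uniq => k; rewrite -mulmxA.
  have <- : jm rG k *m M = M *m jm rG k.
    by rewrite /jm mulmx_suml mulmx_sumr; apply: eq_bigr => x _; apply: comS.
  by rewrite mulmxA v0_wt scalemxAl.
exists a; have fullK : row_full (eigenspace M a).
  apply: v0_gen; last exact/eigenspaceP.
  apply/mxmoduleP => g _; apply/eigenspaceP; rewrite -mulmxA comS mulmxA.
  by rewrite (eigenspaceP (submx_refl _)) scalemxAl.
have /eigenspaceP := submx_full 1%:M fullK.
by rewrite mul1mx => ->; rewrite scalemx1.
Qed.

End SeminormalBasis.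

(** * Specht modules and isotypic components *)

Section Commutant.
Local Open Scope group_scope.
Local Open Scope ring_scope.

Lemma pchar'_group (F : numFieldType) (gT : finGroupType) (G : {group gT}) :
  [pchar F]^'.-group G.
Proof. by apply/pnatP => // p _ _; rewrite inE /= pchar_num. Qed.

(** Converse of Schur's lemma: the projection onto a submodule along a Maschke complement is a
    scalar, so the complement of a nonzero submodule is 0. *)
Lemma commutant_irr (F : numFieldType) (gT : finGroupType) (G : {group gT}) d
    (rG : mx_representation F G d) :
    (0 < d)%N -> (forall M, centgmx rG M -> exists a, M = a%:M) ->
  mx_irreducible rG.
Proof.
move=> d0 scal; apply/mx_irrP; split=> // U modU U0.
have [W modW defW dxUW] := mx_Maschke_pchar rG (pchar'_group F G) modU (submx1 U).
have UW0 := mxdirect_addsP dxUW.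
have [|a Ha] := scal (proj_mx U W).
  apply/centgmxP => g Gg; rewrite -[LHS]mul1mx mulmxA -[X in _ = X]mul1mx mulmxA.
  by apply/esym; move: g Gg; apply/hom_mxP; rewrite -defW proj_mx_hom.
have a1 : a = 1.
  have := proj_mx_id UW0 (submx_refl U); rewrite Ha mul_mx_scalar => /eqP.
  rewrite -subr_eq0 -[X in _ - X]scale1r -scalerBl scaler_eq0 (negbTE U0) orbF subr_eq0.
  by move/eqP.
have W0 : W = 0.
  by have := proj_mx_0 UW0 (submx_refl W); rewrite Ha a1 mulmx1.
by rewrite -sub1mx -defW W0 addsmx0.
Qed.

End Commutant.

Section SpechtModule.
Local Open Scope group_scope.
Local Open Scope ring_scope.
Variables (F : numClosedFieldType) (n : nat) (la : seq nat).
Hypothesis la_part : is_partition n la.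
Local Notation aG := (regular_repr F 'Sym_('I_n)).
Local Notation rS := (specht_repr F n la).
Local Notation S := (specht_mx F n la).
Let modS : mxmodule aG S := cyclic_mx_module aG (young_symmetrizer F n la).

Lemma val_jm (u : 'rV[F]_(\rank S)) k :
  val_submod (u *m jm rS k) = val_submod u *m jm aG k.
Proof.
rewrite /jm !mulmx_sumr linear_sum /=; apply: eq_bigr => i _.
exact: (val_submodJ modS).
Qed.

Lemma weight_val (a : 'I_n -> int) (u : 'rV[F]_(\rank S)) :
  weight rS a u <-> weight aG a (val_submod u).
Proof.
split=> ua k; first by rewrite -val_jm ua linearZ.
by apply: (@val_submod_inj _ _ S); rewrite val_jm ua linearZ.
Qed.

Definition specht_gen : 'rV[F]_(\rank S) := in_submod S (specht_vec F la_part).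

Lemma val_specht_gen : val_submod specht_gen = specht_vec F la_part.
Proof. exact/in_submodK/specht_vec_sub. Qed.

Lemma specht_gen_neq0 : specht_gen != 0.
Proof. by rewrite -(val_submod_eq0 (U := S)) val_specht_gen specht_vec_neq0. Qed.

Lemma specht_gen_weight : weight rS (cont (rtableau la_part)) specht_gen.
Proof.
apply/weight_val => k; rewrite val_specht_gen specht_vec_jm cont_rtableau.
by rewrite rmorphB.
Qed.

Lemma rrow_homo (i j : 'I_n) : (i <= j)%N -> (rrow la_part i <= rrow la_part j)%N.
Proof.
by rewrite leqNgt (rrow_ltn la_part) negb_or => /andP[]; rewrite -leqNgt.
Qed.

(** Consecutive labels in a row of the row reading have contents differing by 1, so their
    transposition fixes [u]; these generate the row group. *)
Lemma weight_rtableau_fixed (u : 'rV[F]_(\rank S)) :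
  weight rS (cont (rtableau la_part)) u ->
  forall s, s \in stabf (rrow la_part) -> u *m rS s = u.
Proof.
move=> uT; apply: stabf_adj_ind => [i j k /andP[le_ij le_jk] eik||g i j adj eij Pg].
- apply/val_inj/eqP; rewrite eqn_leq rrow_homo //= eik; exact: rrow_homo.
- by rewrite repr_mx1 mulmx1.
rewrite rSymM mulmxA Pg (weight_adj_sign (b := false) adj uT) ?scale1r //.
apply: (adj_same_row (part_sorted la_part) adj (rtableau_Std la_part)).
by apply: val_inj; rewrite /= !rtableau_row eij.
Qed.

(** The row symmetrizer multiplies [u] by the order of the row group, yet it sends the whole Specht
    module into the line of [specht_vec]. *)
Lemma specht_gen_uniq (u : 'rV[F]_(\rank S)) :
  weight rS (cont (rtableau la_part)) u -> exists c, u = c *: specht_gen.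
Proof.
move=> uT; have fixu := weight_rtableau_fixed uT.
have /cyclic_mxP[A EA eA] := val_submodP u.
have [c Hc] := specht_vec_uniq la_part EA.
exists (#|stabf (rrow la_part)|%:R^-1 * c); apply: (@val_submod_inj _ _ S).
rewrite linearZ /= val_specht_gen -scalerA -Hc -eA.
have -> : val_submod u *m sgnsum F false (rrow la_part) =
    #|stabf (rrow la_part)|%:R *: val_submod u.
  rewrite /sgnsum mulmx_sumr scaler_nat -sumr_const; apply: eq_bigr => s Hs.
  by rewrite scale1r -(val_submodJ modS) // -[X in val_submod X]/(u *m rS s) fixu.
by rewrite scalerA mulVf ?scale1r // card_stabf_neq0.
Qed.

Lemma specht_gen_full (V : 'M[F]_(\rank S)) :
  mxmodule rS V -> (specht_gen <= V)%MS -> row_full V.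
Proof.
move=> modV sV; rewrite -sub1mx -(val_submodS (U := S)) val_submod1.
have modV' : mxmodule aG (val_submod V) by rewrite (val_submod_module modS).
apply: cyclic_mx_sub (modV') _; apply: submx_trans (young_sub_cyclic _ la_part) _.
by apply: cyclic_mx_sub (modV') _; rewrite -val_specht_gen val_submodS.
Qed.

Lemma D_dim_gt0 : (0 < D_dim F n la)%N.
Proof.
rewrite lt0n mxrank_eq0; apply: contraNneq (specht_vec_neq0 F la_part) => S0.
by have := specht_vec_sub F la_part; rewrite S0 submx0.
Qed.

Lemma rank_eigenspace_specht (i j : 'I_n) mu : j = i.+1 :> nat ->
  \rank (eigenspace (rS (tperm i j) *m (jm rS i + jm rS j)) mu) =
  #|[set T in Std n la | eigval F i j T == mu]|.
Proof.
move=> adj; have [v Hv] := weight_vectors specht_gen_neq0 specht_gen_weight specht_gen_uniq.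
by apply: (rank_eigenspace_jm specht_gen_neq0 specht_gen_weight specht_gen_full (v := v))
  => // T ST; have [] := Hv T ST.
Qed.

Hypothesis la_nonconj : la <> conj_partition la.

Lemma D_repr_irr : mx_irreducible (D_repr F n la).
Proof.
have [v Hv] := weight_vectors specht_gen_neq0 specht_gen_weight specht_gen_uniq.
have v0 T (ST : T \in Std n la) := let: And3 h _ _ := Hv T ST in h.
have vw T (ST : T \in Std n la) := let: And3 _ h _ := Hv T ST in h.
have vu T (ST : T \in Std n la) := let: And3 _ _ h := Hv T ST in h.
apply: commutant_irr D_dim_gt0 _ => M /centgmxP comM.
apply: (alt_commutant_scalar specht_gen_neq0 specht_gen_weight specht_gen_uniq
  specht_gen_full v0 vw vu la_nonconj (nonconj_gt1 la_part la_nonconj)) => g even_g.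
by apply/esym/comM; rewrite Alt_even.
Qed.

End SpechtModule.

(** * The element P in terms of Jucys-Murphy elements *)

Section ThreeCycles.
Local Open Scope group_scope.
Local Open Scope ring_scope.
Variables (F : fieldType) (m : nat).
Local Notation n := m.+2.

Lemma cycle3E (a b c : 'I_n) : cycle3 n a.+1 b.+1 c.+1 = (tperm a b * tperm a c)%g.
Proof. by rewrite /cycle3 /= !valK. Qed.

Lemma tperm_cycle (T : finType) (a b c : T) : c != a -> c != b ->
  (tperm a b * tperm a c = tperm b c * tperm a b)%g.
Proof.
move=> ca cb; have -> : tperm a c = (tperm b c ^ tperm a b)%g.
  by rewrite tpermJ tpermR tpermD // eq_sym.
by rewrite conjgE tpermV !mulgA tperm2 mul1g.
Qed.

Definition ord_prev : 'I_n := Ordinal (leqnSn m.+1).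

(** Abstract in [r], so that P can be read in C[A_n], in D, and in the S_n-module where s and the
    L_k also act. *)
Definition Pelt d (r : {perm 'I_n} -> 'M[F]_d) : 'M[F]_d :=
  r 1%g + \sum_(1 <= i < n.-1) (r (cycle3 n i n.-1 n) + r (cycle3 n i n n.-1)).

Lemma PeltE d (r : {perm 'I_n} -> 'M[F]_d) :
  Pelt r = r 1%g + \sum_(a : 'I_n | (a < m)%N)
    (r (tperm a ord_prev * tperm a ord_max)%g + r (tperm a ord_max * tperm a ord_prev)%g).
Proof.
rewrite /Pelt big_add1 /= big_mkord; congr (_ + _).
rewrite (big_ord_widen n (fun a => r (cycle3 n a.+1 m.+1 m.+2) + r (cycle3 n a.+1 m.+2 m.+1))).
  by apply: eq_bigr => a _; rewrite -!cycle3E.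
by rewrite -addn2 leq_addr.
Qed.

Lemma ltn_ord_prev (a : 'I_n) : (a < m)%N -> (a != ord_prev) && (a != ord_max).
Proof. by rewrite -!(inj_eq val_inj) /=; lia. Qed.

Lemma Pelt_jm d (rG : mx_representation F 'Sym_('I_n) d) :
  Pelt rG = rG (tperm ord_prev ord_max) *m (jm rG ord_prev + jm rG ord_max).
Proof.
have rM (g h : {perm 'I_n}) : rG g *m rG h = rG (g * h)%g by rewrite repr_mxM ?inE.
have -> : jm rG ord_max = rG (tperm ord_prev ord_max) +
    \sum_(a : 'I_n | (a < m)%N) rG (tperm a ord_max).
  rewrite /jm (bigD1 ord_prev) /=; last by [].
  congr (_ + _); apply: eq_bigl => a; rewrite -(inj_eq val_inj) /=; lia.
rewrite PeltE addrCA mulmxDr rM tperm2 -big_split /= mulmx_sumr; congr (_ + _).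
apply: eq_bigr => a /ltn_ord_prev/andP[a1 a2]; rewrite mulmxDr !rM.
have pm : ord_prev != ord_max by rewrite -(inj_eq val_inj) /=; lia.
rewrite (@tperm_cycle _ a ord_prev ord_max); try by rewrite eq_sym.
rewrite (@tperm_cycle _ a ord_max ord_prev) //; last by rewrite eq_sym.
by rewrite (tpermC ord_max).
Qed.

Lemma Pelt_intertwine d1 d2 (r1 : {perm 'I_n} -> 'M_d1) (r2 : {perm 'I_n} -> 'M_d2)
    m1 (U : 'M_(m1, d1)) (B : 'M[F]_(d1, d2)) :
    {in 'Alt_('I_n), forall g, U *m r1 g *m B = U *m B *m r2 g} ->
  U *m Pelt r1 *m B = U *m B *m Pelt r2.
Proof.
move=> hom; rewrite !PeltE !mulmxDr mulmxDl !mulmx_sumr mulmx_suml hom ?group1 //.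
congr (_ + _); apply: eq_bigr => a /ltn_ord_prev/andP[a1 a2].
by rewrite !mulmxDr mulmxDl !hom // Alt_even odd_permM !odd_tperm a1 a2.
Qed.

End ThreeCycles.

(** * From the simple constituent to its isotypic component *)

Section Component.
Local Open Scope group_scope.
Local Open Scope ring_scope.
Variables (F : numClosedFieldType) (m : nat).
Local Notation n := m.+2.
Local Notation G := ('Alt_('I_n))%G.
Variables (sG : irrType F G) (W : sG) (mu : F).
Local Notation aA := (regular_repr F G).
Local Notation Y r := (Pelt r - mu%:M).

Lemma Pelt_shift_intertwine d1 d2 (r1 : {perm 'I_n} -> 'M_d1) (r2 : {perm 'I_n} -> 'M_d2)
    m1 (U : 'M_(m1, d1)) (B : 'M[F]_(d1, d2)) :
    {in 'Alt_('I_n), forall g, U *m r1 g *m B = U *m B *m r2 g} ->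
  U *m Y r1 *m B = U *m B *m Y r2.
Proof.
move=> hom; rewrite !mulmxBr mulmxBl (Pelt_intertwine hom).
by rewrite !mul_mx_scalar scalemxAl.
Qed.

Lemma rank_mul_sum_direct (I : finType) N (U_ : I -> 'M[F]_N) (A : 'M[F]_N) :
    mxdirect (\sum_i U_ i) -> (forall i, (U_ i *m A <= U_ i)%MS) ->
  \rank ((\sum_i U_ i)%MS *m A) = (\sum_i \rank (U_ i *m A))%N.
Proof.
move=> dxU UA; rewrite sumsmxMr_gen.
have dxUA : mxdirect (\sum_i <<U_ i *m A>>).
  apply/mxdirect_sumsP => i _; apply/eqP; rewrite -submx0.
  apply: submx_trans (_ : U_ i :&: \sum_(j | j != i) U_ j <= _)%MS; last first.
    by rewrite (mxdirect_sumsP dxU i isT).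
  apply: capmxS; first by rewrite genmxE.
  by apply: sumsmxS => j _; rewrite genmxE.
rewrite (mxdirectP dxUA) /=; apply: eq_bigr => i _.
by rewrite mxrank_gen.
Qed.

(** Over a closed field the component is a direct sum of as many isomorphic copies as the degree,
    and A preserves each and commutes with the isomorphisms. *)
Lemma rank_component_mul (A : 'M[F]_#|G|) :
    (forall U f : 'M_#|G|, (U <= dom_hom_mx aA f)%MS -> U *m A *m f = U *m f *m A) ->
    (forall U : 'M_#|G|, mxmodule aA U -> (U *m A <= U)%MS) ->
  \rank (W *m A) = (irr_degree W * \rank (socle_base W *m A))%N.
Proof.
move=> homA modA.
have [I U_ /= simU defW dxU] := component_mx_semisimple (socle_simple W).
have isoU i : mx_iso aA (socle_base W) (U_ i).
  apply: (component_mx_iso (socle_simple W) (simU i)).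
  by rewrite -defW (sumsmx_sup i).
have rkU i : \rank (U_ i) = irr_degree W by rewrite -(mxrank_iso (isoU i)).
have cardI : #|I| = irr_degree W.
  have splitG := @group_closure_closed_field F _ G.
  have := irr_mx_mult_pchar (pchar'_group F G) splitG W.
  rewrite /socle_mult -defW (mxdirectP dxU) /= (eq_bigr (fun=> irr_degree W)) //.
  by rewrite sum_nat_const -irr_degreeE mulnK ?irr_degree_gt0.
have rkUA i : \rank (U_ i *m A) = \rank (socle_base W *m A).
  have [f uf homf eqU] := isoU i.
  by rewrite -(eqmxMr _ eqU) -homA // (mxrankMfree (socle_base W *m A)) ?row_free_unit.
have -> : \rank (W *m A) = \rank ((\sum_i U_ i)%MS *m A).
  by rewrite /socle_val -(eqmxMr A defW).
rewrite rank_mul_sum_direct // => [|i].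
  by rewrite (eq_bigr _ (fun i _ => rkUA i)) sum_nat_const cardI.
exact/modA/mxsimple_module.
Qed.

Lemma Pelt_module_sub (U : 'M[F]_#|G|) : mxmodule aA U -> (U *m Y aA <= U)%MS.
Proof.
move=> modU; have UG g : g \in G -> (U *m aA g <= U)%MS.
  by move=> Gg; apply: mxmodule_trans (submx_refl _).
rewrite mulmxBr PeltE mulmxDr mulmx_sumr !addmx_sub ?UG ?group1 //.
  apply: summx_sub => a /ltn_ord_prev/andP[a1 a2].
  by rewrite mulmxDr addmx_sub ?UG // Alt_even odd_permM !odd_tperm a1 a2.
by rewrite eqmx_opp mul_mx_scalar scalemx_sub.
Qed.

(** Ranks of P - mu are easier to transport than its kernels: P - mu has rank d times larger on W
    than on D, and dim W = d * d. *)
Lemma rank_eigenspace_component d (rD : mx_representation F G d) :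
    mx_rsim rD (irr_repr W) ->
  \rank (eigenspace (Pelt aA) mu :&: W)%MS = (d * \rank (eigenspace (Pelt rD) mu))%N.
Proof.
case=> B d_n freeB homB.
have rkY : \rank (Y rD) = \rank (socle_base W *m Y aA).
  rewrite -(mxrankMfree _ freeB) -[Y rD]mul1mx (Pelt_shift_intertwine (r2 := irr_repr W)).
    rewrite mul1mx; have fullB : row_full B by rewrite -col_leq_rank (eqP freeB) d_n.
    rewrite (eqmxMfull _ fullB).
    have free_base : row_free (val_submod (U := socle_base W) 1%:M).
      by rewrite /row_free val_submod1.
    rewrite -(mxrankMfree _ free_base) -[Y _]mul1mx.
    rewrite (Pelt_shift_intertwine (r2 := aA)); last first.
      move=> g Gg; rewrite !mul1mx -val_submodE -[X in val_submod X]mul1mx.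
      exact: val_submodJ.
    by rewrite mul1mx (eqmxMr _ (val_submod1 _)).
  by move=> g Gg; rewrite !mul1mx homB.
have rkW : \rank W = (d * d)%N.
  rewrite -[X in \rank X](mulmx1 (W : 'M_#|G|)) rank_component_mul.
  - by rewrite mulmx1 d_n.
  - by move=> U f _; rewrite !mulmx1.
  by move=> U _; rewrite mulmx1.
have rkWY : \rank (W *m Y aA) = (d * \rank (Y rD))%N.
  rewrite rkY d_n; apply: rank_component_mul => [U f homf|U]; last exact: Pelt_module_sub.
  by apply: Pelt_shift_intertwine => g Gg; apply: (hom_mxP homf).
rewrite capmxC mxrank_ker mulnBr -rkWY -rkW -(mxrank_mul_ker W (Y aA)).
by rewrite addKn.
Qed.

End Component.

(** * The list of eigenvalues *)

Section EigenvalueCount.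
Variables (F : numClosedFieldType) (m : nat) (la : seq nat) (mu : F).
Local Notation n := m.+2.
Hypotheses (la_part : is_partition n la) (la_nonconj : la <> conj_partition la).
Implicit Types T : tableau n.
Local Notation p := (ord_prev m).
Local Notation q := (@ord_max m.+1).
Let sla := part_sorted la_part.
Let sla' := sorted_conj sla.

Lemma ord_prev_max : q = p.+1 :> nat.
Proof. by []. Qed.

Lemma last_contentE T : last_content T = cont T q.
Proof. exact: (nth_contents T q). Qed.

Lemma prev_contentE T : prev_content T = cont T p.
Proof. exact: (nth_contents T p). Qed.

Definition mult T : nat := count_mem mu [seq z%:~R | z <- eigenvalues_of T].

Lemma count_eigenvalue_list nu :
  count_mem mu [seq z%:~R | z <- eigenvalue_list n nu] = (\sum_(T in UStd2 n nu) mult T)%N.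
Proof.
rewrite /eigenvalue_list map_flatten count_flatten -!map_comp sumnE big_map big_enum.
by [].
Qed.

(* The swap makes up for the exchange of order when contents are negated.     *)
Definition flipT T := trT (if generic_adj p q T then swapT p q T else T).

Lemma generic_swapT T : generic_adj p q (swapT p q T) = generic_adj p q T.
Proof. by rewrite /generic_adj !cont_swapT tpermL tpermR; lia. Qed.

Lemma generic_trT T : generic_adj p q (trT T) = generic_adj p q T.
Proof. by rewrite /generic_adj !cont_trT; lia. Qed.

Lemma trT_swapT T : trT (swapT p q T) = swapT p q (trT T).
Proof. by apply/ffunP => k; rewrite !ffunE. Qed.

Lemma flipTK : involutive flipT.
Proof.
move=> T; rewrite /flipT generic_trT.
case gT: (generic_adj p q T); rewrite ?generic_swapT gT; last exact: trTK.
by rewrite -trT_swapT swapTK trTK.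
Qed.

(** In the generic case (a_{n-1}, a_n) becomes (-a_n, -a_{n-1}): the order stays and the sum changes
    sign. Otherwise negation exchanges cases (1) and (2) with equal values. *)
Lemma mult_flipT T : mult (flipT T) = mult T.
Proof.
rewrite /mult /eigenvalues_of !last_contentE !prev_contentE /flipT !cont_trT.
case: (boolP (generic_adj p q T)) => [|]; rewrite /generic_adj ?cont_swapT ?tpermL ?tpermR.
  move: (cont T q) (cont T p) => a b /andP[d1 dN1].
  do 2!(rewrite ifN; last lia).
  do 2!(rewrite [in RHS]ifN; last lia).
  rewrite ltrN2; case: ifP => // _ /=.
  by rewrite (_ : - b - a = - (a + b)) ?opprK ?addn0 1?addnC //; ring.
move: (cont T q) (cont T p) => a b; rewrite negb_and !negbK.
case/orP => /eqP dab.
  have -> : a = b + 1 by lia.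
  rewrite ifN; last lia.
  rewrite ifT; last lia.
  by rewrite eqxx; congr (count_mem mu [seq _ | z <- [:: _]]); lia.
have -> : a = b - 1 by lia.
rewrite ifT; last lia.
rewrite [in RHS]ifN; last lia.
by rewrite eqxx; congr (count_mem mu [seq _ | z <- [:: _]]); lia.
Qed.

Let ord1 : 'I_n := Ordinal (isT : (1 < n)%N).

Lemma Std_ord0 nu T : sorted geq nu -> T \in Std n nu -> cont T ord0 = 0.
Proof.
move=> snu ST; have /codomP[k Tk] : (ord0, ord0) \in codom T.
  rewrite (Std_codom _ ST) (leq_trans _ (nth_sorted_geq snu (leq0n (T ord0).1))) //.
  exact: leq_ltn_trans (leq0n _) (Std_mem ord0 ST).
have le_k : (k <= (ord0 : 'I_n))%N by apply: (Std_nw snu ST); rewrite -Tk.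
have -> : ord0 = k by apply: val_inj; move: le_k; rewrite leqn0 => /eqP.
by rewrite /cont -Tk.
Qed.

(** If the labels 1 and 2 could be swapped, label 2 would already have content 0, like label 1. *)
Lemma Std_ord1 nu T : sorted geq nu -> T \in Std n nu ->
  cont T ord1 = 1 \/ cont T ord1 = -1.
Proof.
move=> snu ST; have c0 := Std_ord0 snu ST.
have adj : ord1 = (ord0 : 'I_n).+1 :> nat by [].
have [gen|] := boolP (generic_adj ord0 ord1 T).
  have := Std_ord0 snu (swapT_Std snu adj ST gen); rewrite cont_swapT tpermL => c1.
  by have := adj_cont_neq snu adj ST; rewrite c0 c1.
by rewrite /generic_adj c0 subr0 negb_and !negbK => /orP[]/eqP; [left | right].
Qed.

Lemma flipT_Std nu T : sorted geq nu -> T \in Std n nu ->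
  flipT T \in Std n (conj_partition nu).
Proof.
move=> snu ST; apply: trT_Std => //; case: ifP => // gen.
exact: (swapT_Std snu ord_prev_max ST gen).
Qed.

(* For n = 3 the swap may move the label 2, but then the conjugate of T is    *)
(* the swapped tableau and the shape is self-conjugate.                       *)
Lemma flipT_ord1 T : T \in Std n la -> cont (flipT T) ord1 = - cont T ord1.
Proof.
move=> ST; rewrite cont_trT; congr (- _); case: ifP => // gen.
have ST' := swapT_Std sla ord_prev_max ST gen.
rewrite cont_swapT; have [le_m1|lt_1m] := leqP m 1; last first.
  by rewrite tpermD // -(inj_eq val_inj) /=; lia.
exfalso; suff eqT : trT T = swapT p q T.
  by have := Std_conj_disjoint la_part la_nonconj ST'; rewrite -eqT trT_Std.
apply: (cont_inj sla' sla (trT_Std sla ST) ST') => k.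
have c0 := Std_ord0 sla ST; have c1 := Std_ord1 sla ST.
have c0' := Std_ord0 sla ST'; have c1' := Std_ord1 sla ST'.
have cpq := adj_cont_neq sla ord_prev_max ST.
(* For n = 2 the contents are 0 and 1 or -1, so T is not generic. *)
have [m0|m_gt0] := posnP m.
  have p0 : p = ord0 by apply: val_inj; rewrite /= m0.
  have q1 : q = ord1 by apply: val_inj; rewrite /= m0.
  move: gen; rewrite /generic_adj p0 q1 c0 subr0 => /andP[d1 dN1].
  by case: c1 => c1; [case/eqP: d1 | case/eqP: dN1].
have p1 : p = ord1 by apply: val_inj => /=; clear -m_gt0 le_m1; lia.
(* For n = 3 the labels 2 and 3 have distinct contents among 1 and -1, so negating and swapping
   agree. *)
move: c1 c1'; rewrite -p1 cont_swapT tpermL => c1 c1'.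
rewrite cont_trT cont_swapT; case: tpermP => [->|->|kp kq].
- by case: c1 c1' cpq => -> [] ->.
- by case: c1 c1' cpq => -> [] ->.
have -> : k = ord0.
  apply: val_inj => /=; have lt_k := ltn_ord k.
  have kp' : k <> p :> nat by move/val_inj.
  have kq' : k <> q :> nat by move/val_inj.
  by move: kp' kq' lt_k => /=; clear -le_m1 m_gt0; lia.
by rewrite c0 oppr0.
Qed.

Lemma UStdE nu T : (T \in UStd n nu) = (T \in Std n nu) && (cont T ord1 == 1).
Proof. by rewrite inE (nth_contents T ord1). Qed.

(** [flipT] matches the tableaux of shape la that are not upper with the upper ones of shape la'. *)
Lemma sum_mult_UStd2 : (\sum_(T in UStd2 n la) mult T = \sum_(T in Std n la) mult T)%N.
Proof.
rewrite (bigID (fun T => T \in UStd n la)) /= [RHS](bigID (fun T => T \in UStd n la)) /=.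
congr (_ + _)%N.
  apply: eq_bigl => T; rewrite in_setU; case A: (T \in UStd n la); rewrite ?andbF ?andbT //=.
  by move: A; rewrite UStdE => /andP[->].
rewrite (reindex_inj (inv_inj flipTK)) /=; apply: eq_big => [T|T _]; last exact: mult_flipT.
rewrite in_setU !UStdE; have [ST|nST] := boolP (T \in Std n la).
  have ST' := flipT_Std sla ST; rewrite ST' flipT_ord1 //=.
  have -> : (flipT T \in Std n la) = false.
    apply/negbTE; apply/negP => ST2.
    by move/negP: (Std_conj_disjoint la_part la_nonconj ST2).
  by case: (Std_ord1 sla ST) => ->.
have [ST'|nST'] := boolP (flipT T \in Std n (conj_partition la)).
  have := flipT_Std sla' ST'; rewrite flipTK conj_partitionK ?(part_neq0 la_part) //.
  by rewrite (negbTE nST).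
by rewrite orbF andbN.
Qed.

Local Notation E T := (eigval F p q T == mu : nat).

Lemma mult_nongeneric T : ~~ generic_adj p q T -> mult T = E T.
Proof.
rewrite /mult /eigenvalues_of last_contentE prev_contentE /eigval /generic_adj.
move: (cont T q) (cont T p) => a b; rewrite negb_and !negbK.
case/orP => /eqP dab.
  have -> : a = b + 1 by lia.
  rewrite eqxx /= addn0 (_ : (b + 1 < b) = false); last by clear; lia.
  rewrite expr0 mul1r; congr (nat_of_bool (_%:~R == _)); clear; lia.
have -> : a = b - 1 by lia.
rewrite ifN; last by clear; lia.
rewrite eqxx /= addn0 (_ : (b - 1 < b) = true); last by clear; lia.
rewrite expr1 mulN1r -mulrNz; congr (nat_of_bool (_%:~R == _)); clear; lia.
Qed.

(** The list attaches both eigenvalues of a pair to the tableau with a_{n-1} < a_n, whereas [eigval]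
    gives one to each member. *)
Lemma mult_generic T : generic_adj p q T ->
  mult T = if cont T p < cont T q then (E T + E (swapT p q T))%N else 0%N.
Proof.
rewrite /mult /eigenvalues_of last_contentE prev_contentE /eigval /generic_adj.
rewrite !cont_swapT tpermL tpermR.
move: (cont T q) (cont T p) => a b /andP[d1 dN1].
do 2!(rewrite ifN; last lia).
case: ifP => //= lt_ba.
rewrite (_ : (a < b) = false); last by clear -lt_ba; lia.
by rewrite expr0 expr1 mul1r mulN1r -mulrNz addn0 (addrC b).
Qed.

Lemma sum_mult_Std :
  (\sum_(T in Std n la) mult T)%N = #|[set T in Std n la | eigval F p q T == mu]|.
Proof.
have -> : #|[set T in Std n la | eigval F p q T == mu]| = (\sum_(T in Std n la) E T)%N.
  rewrite -sum1_card big_mkcond [RHS]big_mkcond; apply: eq_bigr => T _.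
  by rewrite inE; case: (T \in Std n la); case: (_ == mu).
rewrite (bigID (generic_adj p q)) [RHS](bigID (generic_adj p q)) /=.
congr (_ + _)%N; last by apply: eq_bigr => T /andP[_ /mult_nongeneric].
rewrite [RHS](bigID (fun T => cont T p < cont T q)) /=.
rewrite [X in (_ = _ + X)%N](reindex_inj (inv_inj (@swapTK n p q))) /=.
rewrite [X in (_ = _ + X)%N](eq_bigl
  (fun T => (T \in Std n la) && generic_adj p q T && (cont T p < cont T q))).
  rewrite -big_split [RHS]big_mkcondr; apply: eq_bigr => T /andP[_ gen].
  exact: mult_generic.
move=> T; rewrite generic_swapT !cont_swapT tpermL tpermR.
case gen: (generic_adj p q T); rewrite ?andbF ?andbT //=.
have -> : (swapT p q T \in Std n la) = (T \in Std n la).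
  apply/idP/idP => ST; last exact: swapT_Std sla ord_prev_max ST gen.
  rewrite -[T](swapTK p q); apply: swapT_Std sla ord_prev_max ST _.
  by rewrite generic_swapT.
case ST: (T \in Std n la) => //=.
have := adj_cont_neq sla ord_prev_max ST.
by rewrite -leNgt le_eqVlt => /negbTE ->.
Qed.

Lemma count_mem_eigenvalue_list :
  count_mem mu [seq z%:~R | z <- eigenvalue_list n la] =
  #|[set T in Std n la | eigval F p q T == mu]|.
Proof. by rewrite count_eigenvalue_list sum_mult_UStd2 sum_mult_Std. Qed.

End EigenvalueCount.

Theorem theorem2p4 (R : realType) (n : nat) (la : seq nat)
    (la_part : is_partition n la) (la_nonselfconj : la <> conj_partition la) :
  [/\ forall T : tableau n, T \in UStd n la :|: UStd n (conj_partition la) ->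
        let a := last_content T in
        let b := prev_content T in
        [/\ a = b + 1 -> eigenvalue (Pmx R[i] n) (2 * a - 1)%:~R,
            a = b - 1 -> eigenvalue (Pmx R[i] n) (- (2 * a + 1))%:~R
          & a <> b + 1 -> a <> b - 1 -> b < a ->
              eigenvalue (Pmx R[i] n) (a + b)%:~R /\
              eigenvalue (Pmx R[i] n) (- (a + b))%:~R],
      exists W : irrAlt R[i] n,
        mx_rsim (D_repr R[i] n la) (irr_repr W) /\
        forall mu : R[i],
          \rank (eigenspace (Pmx R[i] n) mu :&: W)%MS
          = (D_dim R[i] n la *
             count_mem mu [seq z%:~R | z <- eigenvalue_list n la])%N
    & eigenvalue_list n la =i eigenvalue_list n (conj_partition la)].
Proof.
have n_gt1 := nonconj_gt1 la_part la_nonselfconj.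
case: n la_part n_gt1 => [|[|m]] // la_part _.
pose W := irr_comp (irrAlt R[i] m.+2) (D_repr R[i] m.+2 la).
have simW : mx_rsim (D_repr R[i] m.+2 la) (irr_repr W).
  apply: rsim_irr_comp_pchar.
    exact: pchar'_group.
  exact: D_repr_irr la_part la_nonselfconj.
have rankW mu : \rank (eigenspace (Pmx R[i] m.+2) mu :&: W)%MS =
    (D_dim R[i] m.+2 la * count_mem mu [seq z%:~R | z <- eigenvalue_list m.+2 la])%N.
  have -> : Pmx R[i] m.+2 = Pelt (regular_repr R[i] 'Alt_('I_m.+2)) by [].
  rewrite (rank_eigenspace_component _ simW) (count_mem_eigenvalue_list mu la_part la_nonselfconj).
  rewrite -(rank_eigenspace_specht la_part mu (ord_prev_max m)).
  by rewrite -Pelt_jm.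
(* A positive multiplicity inside W already yields an eigenvector. *)
have eig z : z \in eigenvalue_list m.+2 la -> eigenvalue (Pmx R[i] m.+2) z%:~R.
  move=> z_in; rewrite /eigenvalue -mxrank_eq0 -lt0n.
  apply: leq_trans (mxrankS (capmxSl _ W)); rewrite rankW muln_gt0 D_dim_gt0 //=.
  by rewrite -has_count has_pred1; apply: map_f.
split.
- move=> T UT a b.
  have eigT z : z \in eigenvalues_of T -> eigenvalue (Pmx R[i] m.+2) z%:~R.
    move=> zT; apply: eig; apply/flattenP; exists (eigenvalues_of T) => //.
    by apply: map_f; rewrite mem_enum.
  split=> [ab|ab|/eqP ab1 /eqP ab2 lt_ba].
  + by apply: eigT; rewrite /eigenvalues_of -/a -/b ab eqxx mem_seq1.
  + apply: eigT; rewrite /eigenvalues_of -/a -/b ifN ab ?eqxx ?mem_seq1 //.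
    by clear; lia.
  by split; apply: eigT; rewrite /eigenvalues_of -/a -/b (negbTE ab1) (negbTE ab2) lt_ba
    !inE eqxx ?orbT.
- by exists W.
move=> z; have sla := part_sorted la_part.
by rewrite /eigenvalue_list /UStd2 conj_partitionK ?(part_neq0 la_part) // setUC.
Qed.
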